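(* Under the standing assumptions described in the context, let $A(t,\lambda)$, for $t\in[0,\infty)$ and $\lambda\ge0$ small, be the solution of $\dot A=AX^G(t,\lambda)$, $A(0)=I_3$. Then there exists a sufficiently $CS$ function $Z(t,\lambda)\in q(D)$ such that $A(t,\lambda)=e^{Z(t,\lambda)}$ for $t\in[0,\infty)$ and $\lambda\ge0$ small. In fact, $Z(t,\lambda)$ satisfies, for $t\in[0,\infty)$ and $\lambda\ge0$ small, the initial value problem $$\overrightarrow{\dot Z}=\left[I_3+\tfrac12 Z+\left(\frac1{|Z|^2}-\frac{\cos\frac{|Z|}2}{2|Z|\sin\frac{|Z|}2}\right)Z^2\right]\overrightarrow{X^G(t,\lambda)}\pmod{2\pi},\qquad \overrightarrow{Z(0)}=\overrightarrow{O_3}.$$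
   Context: Regularity conventions. ''Sufficiently smooth'' means of class $C^m$ with $m\ge1$ as large as required, the data being assumed $C^M$ with $M$ large enough. A function $Y(x,\lambda)$, $\lambda\in[0,\lambda_0)$, with values in a smooth manifold is called sufficiently $CS$ if $(x,\epsilon)\mapsto Y(x,\epsilon^2)$ is sufficiently smooth for $\epsilon\in[0,\sqrt{\lambda_0})$. The equation. Let $r>0$, $\mathbf S^2\subset\mathbb R^3$ the unit sphere, $N\ge1$, $D_{\rm diff}=\mathrm{diag}(d_1,\dots,d_N)$ with $d_i\ge0$, $\Delta_S$ the Laplace-Beltrami operator on $r\mathbf S^2$, $F:\mathbb R^N\times\mathbb R\to\mathbb R^N$ of class $C^{k+2}$, $3\le k\le\infty$, with $F(0,\lambda)=0$. Consider $\partial_t u=D_{\rm diff}\Delta_S u+F(u,\lambda)$ on $r\mathbf S^2$. Let $\mathbf Y=L^2(r\mathbf S^2,\mathbb R^N)$ if all $d_i>0$ and $\mathbf Y=H^2(r\mathbf S^2,\mathbb R^N)$ otherwise; let $\alpha\in(\frac12,1)$ and let $\mathbf Y^\alpha$ be the domain of $(I-D_{\rm diff}\Delta_S)^\alpha$. The equation defines a sufficiently smooth local semiflow $\mathbf\Phi(t,u,\lambda)$ on $\mathbf Y^\alpha$, equivariant under the action $(Au)(x)=u(A^{-1}x)$, $A\in SO(3)$. $so(3)$ is the space of real antisymmetric $3\times3$ matrices; $I_3,O_3$ are the identity and zero matrices; for $Y\in so(3)$, $\overrightarrow Y\in\mathbb R^3$ is the vector with $Yw=\overrightarrow Y\times w$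 for all $w$ (so $\overrightarrow{[X,Y]}=\overrightarrow X\times\overrightarrow Y$) and $|Y|=\|\overrightarrow Y\|$. Standing assumptions. $u_0\in\mathbf Y^\alpha$ has trivial isotropy $\{I_3\}$ and is a relative equilibrium, not an equilibrium, at $\lambda=0$: $\mathbf\Phi(t,u_0,0)=e^{X_0t}u_0$, $X_0\in so(3)$, $X_0\ne O_3$. With $L=D_{\rm diff}\Delta_S+D_uF(u_0,0)-X_0$ ($X_0$ acting as infinitesimal generator), assume $\sigma(L)\cap\{\mathrm{Re}\,z\ge0\}$ is a spectral set with spectral projection $P_*$, $\dim R(P_* )=5$, and $|e^{Lt}|_{R(1-P_* )}|\le Ce^{-\beta_0t}$ for some $C,\beta_0>0$. Then (equivariant center manifold reduction), with $V_*$ the orthogonal complement of $T_{u_0}(SO(3)u_0)$ in $R(P_* )$, there are a center manifold $M^{cu}_{u_0}(\lambda)$ diffeomorphic to $SO(3)\times V_*$ via $(A,q)\mapsto A\Psi(q)$ ($\Psi$ a local chart) and sufficiently smooth $X_G:V_*\times\mathbb R\to so(3)$, $X_N:V_*\times\mathbb R\to V_*$ with $X_G(0,0)=X_0$, $X_N(0,0)=0$, such that solutions of $\dot A=AX_G(q,\lambda)$, $\dot q=X_N(q,\lambda)$ correspond to solutions on $M^{cu}_{u_0}(\lambda)$ for $|\lambda|$ small. A supercritical Hopf bifurcation occurs in $\dot q=X_N(q,\lambda)$ at $q=0,\lambda=0$: $X_N(0,\lambda)=0$ for $|\lambda|$ small; $D_qX_N(0,\lambda)$ has eigenvalues $\alpha(\lambda)\pm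 i(\omega_{bif}+\beta(\lambda))$, $\alpha(0)=\beta(0)=0$, $\alpha'(0)>0$, $\omega_{bif}\neq 0$; and a stable periodic solution $q(t,\lambda)=\sqrt\lambda\,r(t,\lambda)=O(\sqrt\lambda)$, sufficiently $CS$, of period $\frac{2\pi}{|\omega_\lambda|}$, $\omega_\lambda=\omega_{bif}+O(\lambda)$, bifurcates for $\lambda>0$ small; $q(t,0)=0$. $X^G(t,\lambda)=X_G(q(t,\lambda),\lambda)$ for $\lambda>0$, and $X^G(t,0)=X_0$, for $t\in[0,\infty)$; it is sufficiently $CS$ and $\frac{2\pi}{|\omega_\lambda|}$-periodic in $t$. The set $q(D)$. The north hemisphere of $\mathbf S^2$ is $\{(x,y,z)\in\mathbf S^2\mid z>0,\text{ or }z=0,\ x\in[-1,1),\ y\in[0,1]\}$, the south hemisphere is its complement. $D$ is the quotient of $\{Y\in so(3)\mid|Y|\le\pi\}$ obtained by identifying $Y$ with $-Y$ when $|Y|=\pi$; it is a model of $\mathbb{R}P^3$, and $[Y]\mapsto e^{Y}$ is a diffeomorphism $D\to SO(3)$. The map $q$ (not to be confused with the variable $q\in V_*$) is $q([Y])=Y$ if $Y=O_3$ or if $\frac1{|Y|}\overrightarrow Y$ and $\frac1{|X_0|}\overrightarrow{X_0}$ are in the same hemisphere, and $q([Y])=\left(1-\frac{2\pi}{|Y|}\right)Y$ otherwise; one has $e^{q([Y])}=e^{Y}$. Elements of norm $2\pi$ are identified with $O_3$, and $q$ is regarded as a smooth map onto $q(D)$, so $q(D)$ carries the smooth structure transported from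 $D$; regularity of $q(D)$-valued functions is with respect to this structure. ''mod $2\pi$'' means that $Z$ is taken up to the identification of $Z$ with $Z+\frac{2k\pi}{|Z|}Z$, $k\in\mathbb Z$ (elements with the same exponential), i.e. the differential equation holds near each $(t,\lambda)$ for a sufficiently $CS$ local representative of norm less than $2\pi$. The coefficient of $Z^2$ is understood by its limit at $Z=O_3$. *)

(* Defs.v *)
From HB Require Import structures.
From mathcomp Require Import all_boot all_order all_algebra.
From mathcomp Require Import all_classical all_reals all_analysis.
From mathcomp Require Import complex ring lra.

Set Implicit Arguments.
Unset Strict Implicit.
Unset Printing Implicit Defensive.

Import Order.TTheory GRing.Theory Num.Theory.
Import numFieldNormedType.Exports.

Local Open Scope classical_set_scope.
Local Open Scope ring_scope.

Section Regularity.
Context {R : realType}.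

(* [Ck n U f]: [f] is of class C^n on the open set [U].  The source is always
   finite-dimensional below, so that [Df] is C^n as soon as all the maps
   [x |-> Df(x) v] are. *)
Fixpoint Ck (E F : normedModType R) (n : nat) (U : set E) (f : E -> F) : Prop :=
  if n is k.+1 then
    (forall x, U x -> differentiable f x) /\
    (forall v, Ck k U (fun x => 'D_v f x))
  else forall x, U x -> {for x, continuous f}.

(* Class C^n on an arbitrary subset (with boundary, or a submanifold):
   existence of a C^n extension to an open neighbourhood. *)
Definition Ck_on (E F : normedModType R) (n : nat) (S : set E) (f : E -> F) :=
  exists (U : set E) (g : E -> F),
    [/\ open U, S `<=` U, Ck n U g & forall x, S x -> f x = g x].

(* "CS of class C^n": [(t, eps) |-> f t (eps ^ 2)] is C^n; [S] is a set of
   pairs [(t, lambda)] with [lambda >= 0]. *)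
Definition CS_on (F : normedModType R) (n : nat) (S : set (R * R))
    (f : R -> R -> F) :=
  Ck_on n [set p : R * R | 0 <= p.2 /\ S (p.1, p.2 ^+ 2)]
        (fun p : R * R => f p.1 (p.2 ^+ 2)).

Definition strip (lam0 : R) : set (R * R) :=
  [set p | 0 <= p.1 /\ 0 <= p.2 < lam0].

(* [f] has derivative [l] at [t], as a function on [0, +oo[ (hence one-sided
   at [t = 0]). *)
Definition deriv_ge0 (F : normedModType R) (f : R -> F) (t : R) (l : F) : Prop :=
  h^-1 *: (f (t + h) - f t) @[h --> within [set h | 0 <= t + h] (0 : R)^'] --> l.

End Regularity.

Section Rotations.
Context {R : realType}.
Implicit Types (X Y Z W : 'M[R]_3) (v w : 'cV[R]_3).

Definition enorm (k : nat) (v : 'cV[R]_k) : R :=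
  Num.sqrt (\sum_i v i 0 ^+ 2).

Definition cross v w : 'cV[R]_3 :=
  \col_i nth 0 [:: v 1 0 * w 2%:R 0 - v 2%:R 0 * w 1 0;
                   v 2%:R 0 * w 0 0 - v 0 0 * w 2%:R 0;
                   v 0 0 * w 1 0 - v 1 0 * w 0 0] i.

Definition so3 Y := Y^T = - Y.

Definition SO3 (A : 'M[R]_3) := A^T *m A = 1%:M /\ \det A = 1.

Definition vec Y : 'cV[R]_3 := \col_i nth 0 [:: Y 2%:R 1; Y 0 2%:R; Y 1 0] i.

Lemma vecP Y w : so3 Y -> Y *m w = cross (vec Y) w.
Proof.
move=> hY.
have h i j : Y j i = - Y i j by have := congr1 (fun M : 'M[R]_3 => M i j) hY; rewrite !mxE.
have h0 i : Y i i = 0.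
  by apply/eqP; rewrite -[_ == 0](mulrn_eq0 _ 2) mulr2n {1}h addNr.
apply/colP => i; rewrite !mxE !big_ord_recl big_ord0 addr0.
have -> : lift ord0 ord0 = 1 :> 'I_3 by apply/val_inj.
have -> : lift ord0 (lift ord0 ord0) = 2%:R :> 'I_3 by apply/val_inj.
have -> : ord0 = 0 :> 'I_3 by apply/val_inj.
case: i => [[|[|[|//]]] lti].
- have -> : Ordinal lti = 0 :> 'I_3 by apply/val_inj.
  rewrite /= h0 (h 1 0); ring.
- have -> : Ordinal lti = 1 :> 'I_3 by apply/val_inj.
  rewrite /= h0 (h 2%:R 1); ring.
- have -> : Ordinal lti = 2%:R :> 'I_3 by apply/val_inj.
  rewrite /= h0 (h 0 2%:R); ring.
Qed.

Definition anorm Y : R := enorm (vec Y).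

Definition expM Y : 'M[R]_3 :=
  limn (series (fun k : nat => (k`!%:R : R)^-1 *: Y ^+ k)).

(* Meant for unit vectors [v = (x, y, z)]. *)
Definition north v : bool :=
  (0 < v 2%:R 0) ||
  [&& v 2%:R 0 == 0, -1 <= v 0 0, v 0 0 < 1, 0 <= v 1 0 & v 1 0 <= 1].

Definition same_hemisphere v w : bool := north v == north w.

(* The model [D] of RP^3 is the closed ball [Dball] with [Y] and [- Y]
   identified when [|Y| = pi]; [qmap X0] is compatible with this
   identification ([qmap_antipode]). *)
Definition Dball : set 'M[R]_3 := [set Y | so3 Y /\ anorm Y <= pi].

Definition qmap X0 Y : 'M[R]_3 :=
  if (Y == 0) || same_hemisphere ((anorm Y)^-1 *: vec Y)
                                 ((anorm X0)^-1 *: vec X0)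
  then Y else (1 - 2 * pi / anorm Y) *: Y.

Lemma vecN Y : vec (- Y) = - vec Y.
Proof.
by apply/colP => -[[|[|[|//]]] lti]; rewrite !mxE.
Qed.

Lemma anormN Y : anorm (- Y) = anorm Y.
Proof.
congr (Num.sqrt _); rewrite vecN; apply: eq_bigr => i _.
by rewrite mxE sqrrN.
Qed.

Lemma north_antipode v : enorm v = 1 -> north (- v) = ~~ north v.
Proof.
rewrite /enorm !big_ord_recl big_ord0 addr0.
have -> : lift ord0 ord0 = 1 :> 'I_3 by apply/val_inj.
have -> : lift ord0 (lift ord0 ord0) = 2%:R :> 'I_3 by apply/val_inj.
have -> : ord0 = 0 :> 'I_3 by apply/val_inj.
rewrite /north !mxE; set x := v 0 0; set y := v 1 0; set z := v 2%:R 0.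
move=> h; have {h} : x ^+ 2 + (y ^+ 2 + z ^+ 2) = 1.
  rewrite -(@sqr_sqrtr _ (_ + _)) ?h ?expr1n //.
  by rewrite !addr_ge0 ?sqr_ge0.
rewrite oppr_gt0 oppr_eq0.
case: (ltgtP z 0) => //= ->; rewrite expr0n addr0 => h.
have hx : -1 <= x <= 1 by apply/andP; split; nra.
have hy : -1 <= y <= 1 by apply/andP; split; nra.
case: (ltgtP y 0) => hy0; last 1 first.
- have : (x - 1) * (x + 1) == 0 by apply/eqP; rewrite hy0 in h; lra.
  rewrite mulf_eq0 => /orP[] /eqP hx1.
    have -> : x = 1 by lra.
    have -> : y = 0 by lra.
    by rewrite oppr0 ltxx lexx !ler01 !andbF !andbT; apply/andP; split; lra.
  have -> : x = - 1 by lra.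
  have -> : y = 0 by lra.
  rewrite oppr0 !opprK ltxx lexx !ler01 !andbF andbT.
  by apply/esym/negbTE; rewrite negbK; lra.
- have -> : 0 <= - y by lra.
  have -> : - 1 <= - x by lra.
  have -> : - y <= 1 by lra.
  have -> : - x < 1 by nra.
  by rewrite /= !andbF.
- have -> : 0 <= - y = false by lra.
  have -> : -1 <= x by lra.
  have -> : y <= 1 by lra.
  have -> : x < 1 by nra.
  by rewrite /= !andbF.
Qed.

Lemma qmap_antipode X0 Y : anorm Y = pi -> qmap X0 (- Y) = qmap X0 Y.
Proof.
move=> hY; have pi0 : (pi : R) != 0 by rewrite gt_eqF ?pi_gt0.
have Y0 : Y != 0.
  apply/eqP => Y0; move: hY; rewrite Y0 /anorm /enorm big1 ?sqrtr0.
    by move/esym/eqP; rewrite (negbTE pi0).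
  by move=> [[|[|[|//]]] lti] _; rewrite !mxE expr0n.
have hn : enorm (pi^-1 *: vec Y) = 1.
  move: hY; rewrite /anorm /enorm => hY.
  under eq_bigr do rewrite mxE exprMn.
  rewrite -mulr_sumr sqrtrM ?sqr_ge0 // hY sqrtr_sqr ger0_norm ?invr_ge0 ?pi_ge0 //.
  by rewrite mulVf.
rewrite /qmap oppr_eq0 (negbTE Y0) anormN hY vecN scalerN /= /same_hemisphere.
rewrite north_antipode //.
have -> : 1 - 2 * pi / pi = - 1 :> R by rewrite mulfK //; ring.
by case: (north _); case: (north _); rewrite /= ?scaleN1r ?opprK.
Qed.

Definition qD X0 : set 'M[R]_3 := qmap X0 @` Dball.

Definition mod2pi Z W :=
  exists k : int, W = Z + (2 * k%:~R * pi / anorm Z) *: Z.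

(* The open ball [|W| < 2 pi] of so(3) covers [D] by the local diffeomorphism
   folding [pi <= |W| < 2 pi] through [W |-> (1 - 2 pi / |W|) W].  Its local
   inverses are the charts of [D], hence of [q(D)]: a [q(D)]-valued function is
   regular iff, locally, it agrees modulo [2 pi] with a regular so(3)-valued
   function of norm less than [2 pi]. *)
Definition local_rep (n : nat) (S : set (R * R)) (Z W : R -> R -> 'M[R]_3) :=
  CS_on n S W /\
  forall p, S p -> [/\ so3 (W p.1 p.2), anorm (W p.1 p.2) < 2 * pi
                     & mod2pi (Z p.1 p.2) (W p.1 p.2)].

Definition CS_qD (n : nat) (S : set (R * R)) (Z : R -> R -> 'M[R]_3) :=
  forall p, S p -> exists (N : set (R * R)) (W : R -> R -> 'M[R]_3),
    [/\ open N, N p & local_rep n (S `&` N) Z W].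

Definition Zcoef_ne0 (s : R) : R :=
  1 / s ^+ 2 - cos (s / 2) / (2 * s * sin (s / 2)).

Definition Zcoef (s : R) : R :=
  if s == 0 then lim (Zcoef_ne0 @ (0 : R)^') else Zcoef_ne0 s.

Definition Zfield Z X : 'cV[R]_3 :=
  (1%:M + 2^-1 *: Z + Zcoef (anorm Z) *: (Z *m Z)) *m vec X.

End Rotations.

Section Sphere.
Context {R : realType}.
Variable r : R.

Definition sphere : set 'cV[R]_3 := [set x | enorm x = r].

(* Spherical coordinates [(theta, phi)] on [r S^2]; the area element is
   [r^2 sin phi dtheta dphi]. *)
Definition sph (p : R * R) : 'cV[R]_3 :=
  \col_i nth 0 [:: r * sin p.2 * cos p.1; r * sin p.2 * sin p.1; r * cos p.2] i.

Definition coord_rect : set (R * R) := `[0, 2 * pi] `*` `[0, pi].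

Definition sphint (f : 'cV[R]_3 -> R) : R :=
  \int[(@lebesgue_measure R \x @lebesgue_measure R)%E]_(p in coord_rect)
    (f (sph p) * (r ^+ 2 * sin p.2)).

Definition sph_ae (T : Type) (f g : 'cV[R]_3 -> T) : Prop :=
  {ae (@lebesgue_measure R \x @lebesgue_measure R)%E,
     forall p, coord_rect p -> f (sph p) = g (sph p)}.

Definition L2fun (f : 'cV[R]_3 -> R) : Prop :=
  measurable_fun coord_rect (f \o sph) /\
  (@lebesgue_measure R \x @lebesgue_measure R)%E.-integrable coord_rect
    (fun p => (f (sph p) ^+ 2 * (r ^+ 2 * sin p.2))%:E).

(* Every smooth function on the sphere is the restriction of such a [phi]. *)
Definition testfun (phi : 'cV[R]_3 -> R) : Prop := forall n, Ck n setT phi.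

(* Laplace-Beltrami operator of [r S^2]: Euclidean Laplacian of the extension
   which is constant along rays. *)
Definition lapS (phi : 'cV[R]_3 -> R) (x : 'cV[R]_3) : R :=
  let psi y := phi ((r / enorm y) *: y) in
  \sum_(i < 3) 'D_(delta_mx i 0) (fun y => 'D_(delta_mx i 0) psi y) x.

Definition eigenbasis (e : nat -> 'cV[R]_3 -> R) (mu : nat -> R) : Prop :=
  [/\ forall j, testfun (e j),
      forall j x, sphere x -> lapS (e j) x = - mu j * e j x,
      forall i j, sphint (fun x => e i x * e j x) = (i == j)%:R &
      forall f, L2fun f -> (forall j, sphint (fun x => f x * e j x) = 0) ->
        sph_ae f (fun=> 0)].

End Sphere.

Definition rotf {R : realType} {T : Type} (A : 'M[R]_3) (u : 'cV[R]_3 -> T) :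
  'cV[R]_3 -> T := fun x => u (invmx A *m x).

(* [rd_reg] is the exponent [k]; a nonlinearity of class C^oo has all these
   finite regularities, so that [k = oo] needs no separate treatment.  The
   number of components is [N = rd_n.+1]. *)
Record rd_system (R : realType) := RDSystem {
  rd_r : R;
  rd_r_gt0 : 0 < rd_r;
  rd_n : nat;
  rd_d : 'I_rd_n.+1 -> R;
  rd_d_ge0 : forall i, 0 <= rd_d i;
  rd_F : 'cV[R]_rd_n.+1 -> R -> 'cV[R]_rd_n.+1;
  rd_reg : nat;
  rd_reg_ge3 : (3 <= rd_reg)%N;
  rd_F_smooth : Ck rd_reg.+2 setT
    (fun p : 'cV[R]_rd_n.+1 * R => rd_F p.1 p.2);
  rd_F0 : forall lam, rd_F 0 lam = 0;
  rd_alpha : R;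
  rd_alpha_bound : 1 / 2 < rd_alpha < 1
}.

Arguments rd_d {R} _ _.
Arguments rd_F {R} _ _ _.

Section PhaseSpaces.
Context {R : realType}.
Variable E : rd_system R.
Implicit Types (phi : 'cV[R]_3 -> R) (i : 'I_(rd_n E).+1) (t lam eps delta : R) (A X : 'M[R]_3).

Local Notation field := ('cV[R]_3 -> 'cV[R]_(rd_n E).+1).

Definition wnorm2 (e : nat -> 'cV[R]_3 -> R)
    (w : 'I_(rd_n E).+1 -> nat -> R) (f : field) (j : nat) : R :=
  \sum_i w i j * sphint (rd_r E) (fun x => f x i 0 * e j x) ^+ 2.

(* [realizes e w ev]: [Y] is the Hilbert space of the (classes of)
   L^2 fields [f] on [r S^2] with
   [sum_j sum_i w_ij <f_i, e_j>^2 < oo], where [(e_j)] is an orthonormal basis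
   of eigenfunctions of the Laplace-Beltrami operator; [ev u] is a
   representative of [u]. *)
Record realizes (e : nat -> 'cV[R]_3 -> R) (w : 'I_(rd_n E).+1 -> nat -> R)
    (Y : completeNormedModType R) (ev : Y -> field) : Prop := Realizes {
  ev_L2 : forall u i, L2fun (rd_r E) (fun x => ev u x i 0);
  ev_lin : forall (c : R) u v,
    sph_ae (rd_r E) (ev (c *: u + v)) (fun x => c *: ev u x + ev v x);
  ev_norm : forall u, series (wnorm2 e w (ev u)) @ \oo --> `|u| ^+ 2;
  ev_onto : forall f : field,
    (forall i, L2fun (rd_r E) (fun x => f x i 0)) ->
    cvgn (series (wnorm2 e w f)) ->
    exists u, sph_ae (rd_r E) (ev u) f
}.

(* L^2 if all [d_i > 0], otherwise H^2 (domain of [I - Delta_S], with the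
   graph norm). *)
Definition weightY (mu : nat -> R) (i : 'I_(rd_n E).+1) (j : nat) : R :=
  if [forall l, 0 < rd_d E l] then 1 else (1 + mu j) ^+ 2.

(* Domain in [Y] of [(I - D_diff Delta_S)^alpha], with the graph norm. *)
Definition weightYa (mu : nat -> R) (i : 'I_(rd_n E).+1) (j : nat) : R :=
  weightY mu i j * ((1 + rd_d E i * mu j) `^ rd_alpha E) ^+ 2.

(* [alpha > 1/2] makes the elements of [Y^alpha] continuous: [ps_ev] takes the
   continuous representative. *)
Record phase_spaces := PhaseSpaces {
  ps_e : nat -> 'cV[R]_3 -> R;
  ps_mu : nat -> R;
  ps_basis : eigenbasis (rd_r E) ps_e ps_mu;
  ps_Y : completeNormedModType R;
  ps_evY : ps_Y -> field;
  ps_realY : realizes ps_e (weightY ps_mu) ps_evY;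
  ps_Ya : completeNormedModType R;
  ps_ev : ps_Ya -> field;
  ps_realYa : realizes ps_e (weightYa ps_mu) ps_ev;
  ps_cont : forall u, {within sphere (rd_r E), continuous (ps_ev u)};
  ps_act : 'M[R]_3 -> ps_Ya -> ps_Ya;
  ps_actE : forall A u, SO3 A -> forall x, sphere (rd_r E) x ->
    ps_ev (ps_act A u) x = rotf A (ps_ev u) x
}.

Variable H : phase_spaces.
Local Notation Y := (ps_Y H).
Local Notation Ya := (ps_Ya H).
Local Notation r := (rd_r E).

Definition incl (u : Ya) (v : Y) : Prop := sph_ae r (ps_ev u) (ps_evY v).

(* Trajectories on [0, T[ of the local semiflow [Phi( . , . , lam)] on
   [Y^alpha]: continuous curves satisfying
   [d_t u = D_diff Delta_S u + F(u, lam)] in the weak sense. *)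
Definition pde_solution (lam : R) (T : \bar R) (U : R -> Ya) : Prop :=
  {within [set t | 0 <= t /\ (t%:E < T)%E], continuous U} /\
  forall phi i t, testfun phi -> 0 < t -> (t%:E < T)%E ->
    is_derive t (1 : R) (fun s => sphint r (fun x => ps_ev (U s) x i 0 * phi x))
      (sphint r (fun x => rd_d E i * ps_ev (U t) x i 0 * lapS r phi x +
                          rd_F E (ps_ev (U t) x) lam i 0 * phi x)).

Record relative_equilibrium (u0 : Ya) (X0 : 'M[R]_3) : Prop := RelEq {
  req_isotropy : forall A, SO3 A -> ps_act A u0 = u0 -> A = 1%:M;
  req_so3 : so3 X0;
  req_X0 : X0 <> 0;
  req_flow : pde_solution 0 +oo%E (fun t => ps_act (expM (t *: X0)) u0);
  req_not_eq : ~ pde_solution 0 +oo%E (fun=> u0)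
}.

Section Linearization.
Variables (u0 : Ya) (X0 : 'M[R]_3).

(* [< (L v)_i, phi >] in the sense of distributions, with
   [L = D_diff Delta_S + D_u F(u0, 0) - X0]; since
   [(X0 v)(x) = d/ds v(e^{- s X0} x)] at [s = 0] and rotations preserve the
   area, [< - X0 v, phi > = < v, X0 phi >]. *)
Definition weakL (v : field) (phi : 'cV[R]_3 -> R) (i : 'I_(rd_n E).+1) : R :=
  sphint r (fun x =>
    rd_d E i * v x i 0 * lapS r phi x +
    ('D_(v x) (fun z => rd_F E z 0) (ps_ev u0 x)) i 0 * phi x +
    v x i 0 * 'D_(- (X0 *m x)) phi x).

(* Graph of [L] in [Y]. *)
Definition opL (v w : Y) : Prop := forall phi i, testfun phi ->
  sphint r (fun x => ps_evY w x i 0 * phi x) = weakL (ps_evY v) phi i.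

(* Trajectories [t |-> e^{L t} v]. *)
Definition lin_solution (V : R -> Y) : Prop :=
  {within [set t | 0 <= t], continuous V} /\
  forall phi i t, testfun phi -> 0 < t ->
    is_derive t (1 : R) (fun s => sphint r (fun x => ps_evY (V s) x i 0 * phi x))
      (weakL (ps_evY (V t)) phi i).

(* [a + i b] is in the resolvent set of the part of [L] in the
   (complexification of the) subspace [K]; [v.1 + i v.2] is the solution of
   [(a + i b - L) v = f.1 + i f.2]. *)
Definition in_resolvent (K : set Y) (z : R * R) : Prop :=
  forall f : Y * Y, K f.1 -> K f.2 ->
    exists! v : Y * Y,
      [/\ K v.1, K v.2,
          opL v.1 (z.1 *: v.1 - z.2 *: v.2 - f.1) &
          opL v.2 (z.2 *: v.1 + z.1 *: v.2 - f.2)].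

Definition spectrum (K : set Y) : set (R * R) := [set z | ~ in_resolvent K z].

Definition unstable_part : set (R * R) :=
  spectrum setT `&` [set z | 0 <= z.1].

Definition is_basis (k : nat) (K : set Y) (b : 'I_k -> Y) : Prop :=
  (forall l, K (b l)) /\
  forall v, K v -> exists! c : 'rV[R]_k, v = \sum_l c 0 l *: b l.

(* Spectral set: compact and relatively clopen in the spectrum.  [P] is its
   spectral projection [P_*]: it reduces [L], and the parts of [L] in the
   range and in the kernel of [P] have for spectra the spectral set and its
   complement. *)
Record spectral_hypothesis (P : {linear Y -> Y}) : Prop := SpectralHyp {
  sp_compact : compact unstable_part;
  sp_closed : closed (spectrum setT `\` unstable_part);
  sp_continuous : continuous P;
  sp_idem : forall v, P (P v) = P v;
  sp_comm : forall v w, opL v w -> opL (P v) (P w);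
  sp_dom : forall v, exists w, opL (P v) w;
  sp_unstable : spectrum (range P) = unstable_part;
  sp_stable : spectrum [set v | P v = 0] = spectrum setT `\` unstable_part;
  sp_dim : exists b : 'I_5 -> Y, is_basis (range P) b;
  sp_decay : exists C beta0 : R, [/\ 0 < C, 0 < beta0 &
    forall V, lin_solution V -> P (V 0) = 0 ->
      forall t, 0 <= t -> `|V t| <= C * expR (- beta0 * t) * `|V 0|]
}.

(* [T_{u0}(SO(3) u0) = {X u0 | X in so(3)}]. *)
Definition orbit_tangent : set Y :=
  [set g | exists2 X, so3 X & forall phi i, testfun phi ->
     sphint r (fun x => ps_evY g x i 0 * phi x) =
     sphint r (fun x => ps_ev u0 x i 0 * 'D_(X *m x) phi x)].

(* Scalar product of the Hilbert space [Y], by polarization. *)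
Definition ipY (v g : Y) : R := 4^-1 * (`|v + g| ^+ 2 - `|v - g| ^+ 2).

Definition Vstar (P : Y -> Y) : set Y :=
  [set v | range P v /\ forall g, orbit_tangent g -> ipY v g = 0].

End Linearization.

(* Solutions on [0, T[ of [A' = A XG(q, lam)], [q' = XN(q, lam)].  Points of
   [V_*] are given by their coordinates [q : 'rV_2] in a basis. *)
Definition reduced_solution (XG : 'rV[R]_2 -> R -> 'M[R]_3)
    (XN : 'rV[R]_2 -> R -> 'rV[R]_2) (lam : R) (T : \bar R)
    (A : R -> 'M[R]_3) (q : R -> 'rV[R]_2) : Prop :=
  forall t, 0 <= t -> (t%:E < T)%E ->
    deriv_ge0 A t (A t *m XG (q t) lam) /\ deriv_ge0 q t (XN (q t) lam).

(* The center manifold at [lam] is the image of the embedding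
   [(A, q) |-> A Psi(q)], where the chart [Psi] (which depends on [lam], as
   the manifold does) is defined on a neighbourhood [U] of [0] in [V_*]; at
   [lam = 0] it contains [u0] and is tangent there to the range of [P]. *)
Record center_manifold (M : nat) (u0 : Ya) (X0 : 'M[R]_3) (P : Y -> Y)
    (lam0 : R) (U : set 'rV[R]_2) (Psi : 'rV[R]_2 -> R -> Ya)
    (XG : 'rV[R]_2 -> R -> 'M[R]_3) (XN : 'rV[R]_2 -> R -> 'rV[R]_2)
    : Prop := CenterManifold {
  cm_open : open U;
  cm_0 : U 0;
  cm_u0 : Psi 0 0 = u0;
  cm_smooth : Ck_on M
    [set p : 'M[R]_3 * ('rV[R]_2 * R) |
       [/\ SO3 p.1, U p.2.1 & `|p.2.2| < lam0]]
    (fun p => ps_act p.1 (Psi p.2.1 p.2.2));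
  cm_inj : forall lam A A' (q q' : 'rV[R]_2), `|lam| < lam0 -> SO3 A -> SO3 A' ->
    U q -> U q' -> ps_act A (Psi q lam) = ps_act A' (Psi q' lam) ->
    A = A' /\ q = q';
  cm_immersion : forall lam (q : 'rV[R]_2) X (v : 'rV[R]_2), `|lam| < lam0 -> U q -> so3 X ->
    is_derive (0 : R) (1 : R)
      (fun s => ps_act (expM (s *: X)) (Psi (q + s *: v) lam)) 0 ->
    X = 0 /\ v = 0;
  cm_inverse : forall lam A q, `|lam| < lam0 -> SO3 A -> U q ->
    forall eps, 0 < eps -> exists2 delta, 0 < delta &
    forall A' q', SO3 A' -> U q' ->
      `|ps_act A' (Psi q' lam) - ps_act A (Psi q lam)| < delta ->
      `|A' - A| < eps /\ `|q' - q| < eps;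
  cm_tangent : forall X (v : 'rV[R]_2) w, so3 X ->
    is_derive (0 : R) (1 : R)
      (fun s => ps_act (expM (s *: X)) (Psi (s *: v) 0)) w ->
    exists2 g, range P g & incl w g;
  cm_XG_smooth : Ck M setT (fun p : 'rV[R]_2 * R => XG p.1 p.2);
  cm_XG_so3 : forall q lam, so3 (XG q lam);
  cm_XN_smooth : Ck M setT (fun p : 'rV[R]_2 * R => XN p.1 p.2);
  cm_XG0 : XG 0 0 = X0;
  cm_XN0 : XN 0 0 = 0;
  cm_flow : forall lam T (A : R -> 'M[R]_3) q, `|lam| < lam0 -> (0 < T)%E ->
    (forall t, 0 <= t -> (t%:E < T)%E -> SO3 (A t) /\ U (q t)) ->
    reduced_solution XG XN lam T A q <->
    pde_solution lam T (fun t => ps_act (A t) (Psi (q t) lam))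
}.

End PhaseSpaces.

Section Hopf.
Context {R : realType}.
Implicit Types (t lam eps delta : R).

(* Orbital stability of [{q(t) | t >= 0}]. *)
Definition orbitally_stable (f : 'rV[R]_2 -> 'rV[R]_2) (q : R -> 'rV[R]_2) :=
  forall eps, 0 < eps -> exists2 delta, 0 < delta &
  forall (T : R) (p : R -> 'rV[R]_2),
    (forall t, 0 <= t < T -> deriv_ge0 p t (f (p t))) ->
    (exists2 s, 0 <= s & `|p 0 - q s| < delta) ->
    forall t, 0 <= t < T -> exists2 s, 0 <= s & `|p t - q s| < eps.

(* The eigenvalues of [D_q XN(0, lam)] are
   [a lam +/- i (omega_bif + b lam)]. *)
Record supercritical_hopf (M : nat) (lam0 : R)
    (XN : 'rV[R]_2 -> R -> 'rV[R]_2) (a b : R -> R) (omega_bif : R)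
    (omega : R -> R) (q : R -> R -> 'rV[R]_2) : Prop := SupercriticalHopf {
  hopf_trivial : forall lam, `|lam| < lam0 -> XN 0 lam = 0;
  hopf_eig : forall lam, `|lam| < lam0 ->
    let J := map_mx (real_complex R) (jacobian (fun z => XN z lam) 0) in
    eigenvalue J (a lam +i* (omega_bif + b lam))%C /\
    eigenvalue J (a lam -i* (omega_bif + b lam))%C;
  hopf_a0 : a 0 = 0;
  hopf_b0 : b 0 = 0;
  hopf_a'0 : derivable a 0 1 /\ 0 < 'D_1 a 0;
  hopf_omega_bif : omega_bif != 0;
  hopf_smooth : CS_on M (strip lam0) q;
  hopf_amplitude : exists (rho : R -> R -> 'rV[R]_2) (C : R),
    forall t lam, 0 <= t -> 0 <= lam < lam0 ->
      q t lam = Num.sqrt lam *: rho t lam /\ `|rho t lam| <= C;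
  hopf_q0 : forall t, 0 <= t -> q t 0 = 0;
  hopf_solution : forall t lam, 0 <= t -> 0 < lam < lam0 ->
    deriv_ge0 (fun s => q s lam) t (XN (q t lam) lam);
  hopf_omega : (forall lam, 0 <= lam < lam0 -> omega lam != 0) /\
    exists C, forall lam, 0 <= lam < lam0 ->
      `|omega lam - omega_bif| <= C * lam;
  hopf_periodic : forall t lam, 0 <= t -> 0 < lam < lam0 ->
    q (t + 2 * pi / `|omega lam|) lam = q t lam;
  hopf_nonconstant : forall lam, 0 < lam < lam0 ->
    exists2 t, 0 <= t & q t lam <> q 0 lam;
  hopf_stable : forall lam, 0 < lam < lam0 ->
    orbitally_stable (fun z => XN z lam) (fun t => q t lam)
}.

Definition XGt (XG : 'rV[R]_2 -> R -> 'M[R]_3) (X0 : 'M[R]_3)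
    (q : R -> R -> 'rV[R]_2) (t lam : R) : 'M[R]_3 :=
  if lam == 0 then X0 else XG (q t lam) lam.

End Hopf.

(* Main.v *)
Require Import Defs.
From HB Require Import structures.
From mathcomp Require Import all_boot all_order all_algebra.
From mathcomp Require Import all_classical all_reals all_analysis.
From mathcomp Require Import ring lra.

Set Implicit Arguments.
Unset Strict Implicit.
Unset Printing Implicit Defensive.

Import Order.TTheory GRing.Theory Num.Theory.
Import numFieldNormedType.Exports.

Local Open Scope classical_set_scope.
Local Open Scope ring_scope.

(** The rotations A(t, lambda) are lifted to unit quaternions and Z is read off
    from the logarithm of the lift. Put lambda = x^2. By the conventions on CS
    functions, the angular velocity X^G is a function of class C^m of (t, x) on a
    neighbourhood of the quarter strip of all t >= 0 and x >= 0 with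
    x^2 < lambda_0 ([angular_velocity_CS]).

    Smoothness of the lift. The equation Q' = Q X / 2 is linear in the quaternion
    Q, preserves |Q|, and the rotation matrix R(Q) satisfies R(Q)' = R(Q) X. Hence
    R(Q) = A when Q starts at 1 ([attitude_unique]). Solutions of linear equations
    are as smooth in a parameter as the coefficients ([ode_smooth_dependence]),
    so Q is of class C^m in (t, x).

    The logarithm. If Q is not -1, write Q = cos(theta / 2) + sin(theta / 2) n
    with 0 <= theta < 2 pi. The stereographic projection v of Q from -1 is
    tan(theta / 4) n, so W = theta n equals 4 g(|v|^2) v with g(s^2) = atan s / s.
    As g is smooth on a neighbourhood of [0, oo[ ([atan_quotient_smooth]), W is a
    smooth function of Q; by Rodrigues' formula e^W = R(Q) ([expM_quat_log]), and
    the chain rule along Q' = Q X / 2 gives the differential equation of the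
    statement for W ([quat_log_flow]).

    Conclusion. As R(-Q) = R(Q), the sign of the lift can be chosen near each point
    so that its real part is nonnegative at that point. There |W| <= pi, which
    gives a logarithm Y of A in the ball of radius pi, and Z = q(Y). Nearby Q stays
    away from -1, and W is a local representative of norm less than 2 pi of class
    C^m. It agrees with Z modulo 2 pi because both are logarithms of A in the open
    ball of radius 2 pi ([mod2pi_expM]). *)

(** * Calculus of functions of class C^n *)

Section CkToolbox.
Context {R : realType}.
Implicit Types E F G : normedModType R.

(** Lets differentiability follow from a plain estimate, and identifies the
    differential at the same time. *)
Lemma differentiable_eps E F (f : E -> F) (x : E) (L : {linear E -> F}) :
  continuous L ->
  (forall e : R, 0 < e ->
     \forall h \near 0, `|f (h + x) - f x - L h| <= e * `|h|) ->
  differentiable f x /\ forall v, 'd f x v = L v.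
Proof.
move=> cL H.
have D : f \o shift x = cst (f x) + L +o_ 0 id.
  apply/eqaddoP => e e0; near=> h.
  rewrite /= !fctE /= opprD addrA.
  near: h; exact: H.
have dE := diff_unique cL D.
split; last by move=> v; rewrite dE.
by apply/diff_locallyP; rewrite dE.
Unshelve. all: by end_near. Qed.

Lemma differentiable_near_eq E F (f g : E -> F) (x : E) :
  (\forall y \near x, f y = g y) -> differentiable f x -> differentiable g x.
Proof.
move=> fg df.
have fgx : f x = g x by exact: nbhs_singleton fg.
apply: (proj1 (@differentiable_eps _ _ g x ('d f x) _ _)).
  exact: diff_continuous.
move=> e e0.
have := diff_locally df => /eqaddoP /(_ e e0) Hf.
have Hg : \forall h \near 0, f (h + x) = g (h + x).
  by move: fg; rewrite (near_shift 0 x) /=; apply: filterS => h; rewrite /= subr0.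
apply: filterS2 Hf Hg => h Hf <-.
by rewrite -fgx -addrA -opprD.
Qed.

(** Class C^n is a local notion on an open set; hence the rules of derivation
    need only hold at the points of that set. *)
Lemma Ck_ext E F n (U : set E) (f g : E -> F) :
  open U -> (forall x, U x -> f x = g x) -> Ck n U f -> Ck n U g.
Proof.
move=> oU; elim: n f g => [|n IH] f g fg /=.
  move=> cf x Ux.
  have nfg : \forall y \near x, f y = g y.
    by apply: filterS (open_nbhs_nbhs (conj oU Ux)) => y /fg.
  rewrite /prop_for /continuous_at -(fg x Ux).
  apply: cvg_trans (cf x Ux); exact: near_eq_cvg.
have nfg x : U x -> \forall y \near x, f y = g y.
  by move=> Ux; apply: filterS (open_nbhs_nbhs (conj oU Ux)) => y /fg.
move=> [df Df]; split=> [x Ux|v].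
  exact: differentiable_near_eq (nfg _ Ux) (df _ Ux).
apply: IH (Df v) => x Ux; apply: near_eq_derive; exact: nfg.
Qed.

Lemma Ck_cont E F n (U : set E) (f : E -> F) x :
  Ck n U f -> U x -> {for x, continuous f}.
Proof.
case: n => [|n] /=; first exact.
by move=> [df _] Ux; apply: differentiable_continuous; exact: df.
Qed.

Lemma Ck_pred E F n (U : set E) (f : E -> F) : Ck n.+1 U f -> Ck n U f.
Proof.
elim: n f => [|n IH] f.
  by move=> H x Ux; apply: Ck_cont H Ux.
by case=> df Df; split=> // v; apply: IH; exact: Df.
Qed.

Lemma Ck_sub E F n (U V : set E) (f : E -> F) :
  V `<=` U -> Ck n U f -> Ck n V f.
Proof.
move=> VU; elim: n f => [|n IH] f /=; first by move=> H x /VU; exact: H.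
by move=> [df Df]; split=> [x /VU|v]; [exact: df|apply: IH; exact: Df].
Qed.

Lemma Ck_cst E F n (U : set E) (c : F) : Ck n U (fun _ : E => c).
Proof.
elim: n c => [|n IH] c /=; first by move=> x _; exact: cst_continuous.
split=> [x _|v]; first exact: differentiable_cst.
have -> : (fun x : E => 'D_v (fun=> c) x) = fun=> 0.
  by apply/funext => x; exact: derive_cst.
exact: IH.
Qed.

Lemma Ck_add E F n (U : set E) (f g : E -> F) : open U ->
  Ck n U f -> Ck n U g -> Ck n U (fun x => f x + g x).
Proof.
move=> oU; elim: n f g => [|n IH] f g /=.
  by move=> cf cg x Ux; apply: cvgD; [exact: cf|exact: cg].
move=> [df Df] [dg Dg]; split=> [x Ux|v].
  by apply: differentiableD; [exact: df|exact: dg].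
apply: Ck_ext (IH _ _ (Df v) (Dg v)) => // x Ux.
by rewrite -deriveD //; apply: diff_derivable; [exact: df|exact: dg].
Qed.

(** A continuous linear map commutes with directional derivatives. Coordinates,
    projections and matrix entries inherit their regularity from this. *)
Lemma Ck_linpost E F G n (U : set E) (L : F -> G) (f : E -> F) :
  open U -> linear L -> continuous L -> Ck n U f -> Ck n U (fun x => L (f x)).
Proof.
move=> oU lL cL.
pose L' : {linear F -> G} := HB.pack L (GRing.isLinear.Build _ _ _ _ L lL).
have dL y : differentiable L y by apply: (@linear_differentiable _ _ _ L').
have DL y : 'd L y = L :> (F -> G) by apply: (@diff_lin _ _ _ L').
elim: n f => [|n IH] f /=.
  by move=> cf x Ux; apply: (cvg_comp _ _ (cf x Ux)); exact: cL.
move=> [df Df]; split=> [x Ux|v].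
  by apply: (@differentiable_comp _ _ _ _ f L) => //; exact: df.
apply: Ck_ext (IH _ (Df v)) => // x Ux.
have dfx := df x Ux.
rewrite (@deriveE _ _ _ (L \o f)); last exact: differentiable_comp.
by rewrite diff_comp //= DL deriveE.
Qed.

Lemma Ck_mul E n (U : set E) (f g : E -> R) : open U ->
  Ck n U f -> Ck n U g -> Ck n U (fun x => f x * g x).
Proof.
move=> oU; elim: n f g => [|n IH] f g.
  by move=> cf cg x Ux; apply: cvgM; [exact: cf|exact: cg].
move=> Hf Hg; move: (Hf) (Hg) => [df Df] [dg Dg]; split=> [x Ux|v].
  by apply: differentiableM; [exact: df|exact: dg].
apply: (@Ck_ext _ _ _ _ (fun x => f x * 'D_v g x + g x * 'D_v f x)) => //.
  by move=> x Ux; rewrite deriveM //; apply: diff_derivable; [exact: df|exact: dg].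
apply: (Ck_add oU).
  by apply: IH; [exact: (Ck_pred Hf)|exact: Dg].
by apply: IH; [exact: (Ck_pred Hg)|exact: Df].
Qed.

Lemma Ck_sum E F n (U : set E) (I : finType) (f : I -> E -> F) : open U ->
  (forall i, Ck n U (f i)) -> Ck n U (fun x => \sum_i f i x).
Proof.
move=> oU H; elim: (index_enum I) => [|i s IH].
  by apply: Ck_ext (Ck_cst _ _ 0) => // x _; rewrite big_nil.
apply: Ck_ext (Ck_add oU (H i) IH) => // x _; by rewrite big_cons.
Qed.

Lemma Ck_inv E n (U : set E) (f : E -> R) : open U ->
  (forall x, U x -> f x != 0) -> Ck n U f -> Ck n U (fun x => (f x)^-1).
Proof.
move=> oU f0; elim: n => [|n IH].
  by move=> cf x Ux; apply: cvgV; [exact: f0|exact: cf].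
move=> Hf; move: (Hf) => [df Df]; split=> [x Ux|v].
  by apply: differentiableV; [exact: df|exact: f0].
have Hi : Ck n U (fun x => (f x)^-1) by apply: IH; exact: Ck_pred.
apply: (@Ck_ext _ _ _ _ (fun x => (- 1 * ((f x)^-1 * (f x)^-1)) * 'D_v f x)) => //.
  move=> x Ux; rewrite (deriveV (f0 _ Ux) (diff_derivable (df _ Ux))).
  by rewrite /GRing.scale /= expr2 invfM mulN1r.
apply: (Ck_mul oU _ (Df v)); apply: (Ck_mul oU); [exact: Ck_cst|exact: Ck_mul].
Qed.

(** The derivative of [f] is taken in the direction ['D_v g x], which varies with
    the point; expanded in a fixed basis [b] with coordinate forms [c], it becomes
    a sum of products of a coordinate of ['D_v g] and a fixed directional
    derivative of [f] composed with [g], to which the induction applies. *)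
Lemma Ck_comp E F n k (b : 'I_k -> F) (c : 'I_k -> F -> R)
    (U : set E) (V : set F) (f : F -> R) (g : E -> F) :
  (forall i, linear (c i : F -> R^o)) -> (forall i, continuous (c i)) ->
  (forall w, w = \sum_i c i w *: b i) ->
  open U -> (forall x, U x -> V (g x)) ->
  Ck n V f -> Ck n U g -> Ck n U (fun x => f (g x)).
Proof.
move=> lc cc bc oU UV; elim: n f => [|n IH] f.
  move=> cf cg x Ux; apply: (cvg_comp _ _ (cg x Ux)); exact: cf (UV _ Ux).
move=> [df Df] Hg; move: (Hg) => [dg Dg]; split=> [x Ux|v].
  by apply: (@differentiable_comp _ _ _ _ g f); [exact: dg|exact: df (UV _ Ux)].
apply: (@Ck_ext _ _ _ _ (fun x => \sum_i c i ('D_v g x) * 'D_(b i) f (g x))) => //.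
  move=> x Ux; have dgx := dg x Ux; have dfx := df _ (UV _ Ux).
  rewrite (@deriveE _ _ _ (f \o g)); last exact: differentiable_comp.
  rewrite diff_comp //= -(deriveE v dgx) [in RHS](bc ('D_v g x)) (linear_sum ('d f (g x))) /=.
  by apply: eq_bigr => i _; rewrite linearZ /= (deriveE (b i) dfx).
apply: (Ck_sum oU) => i; apply: (Ck_mul oU); first exact: (Ck_linpost oU (lc i)  (cc i) (Dg v)).
exact: (IH _ (Df (b i)) (Ck_pred Hg)).
Qed.

Lemma Ck_id E n (U : set E) : Ck n U (fun x : E => x).
Proof.
case: n => [|n] /=; first by move=> x _; exact: cvg_id.
split=> [x _|v]; first exact: ex_diff.
have -> : (fun x : E => 'D_v (fun x : E => x) x) = fun=> v.
  by apply/funext => x; exact: derive_id.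
exact: Ck_cst.
Qed.

Lemma Ck_fst n (U : set (R * R)) : open U -> Ck n U (fun p : R * R => p.1).
Proof.
move=> oU; apply: (@Ck_linpost _ _ R n U (fst : R * R -> R)) => //.
  by move=> p; exact: cvg_fst.
exact: Ck_id.
Qed.

Lemma Ck_snd n (U : set (R * R)) : open U -> Ck n U (fun p : R * R => p.2).
Proof.
move=> oU; apply: (@Ck_linpost _ _ R n U (snd : R * R -> R)) => //.
  by move=> p; exact: cvg_snd.
exact: Ck_id.
Qed.

Lemma Ck_opp E n (U : set E) (f : E -> R) : open U ->
  Ck n U f -> Ck n U (fun x => - f x).
Proof.
move=> oU Cf; apply: Ck_ext (Ck_mul oU (@Ck_cst E R n U (-1)) Cf) => // x _.
by rewrite mulN1r.
Qed.

Lemma Ck_pair E F G n (U : set E) (f : E -> F) (g : E -> G) : open U ->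
  Ck n U f -> Ck n U g -> Ck n U (fun x => (f x, g x)).
Proof.
move=> oU Cf Cg.
have h1 : Ck n U (fun x => (f x, 0 : G)).
  apply: (@Ck_linpost _ F (F * G)%type n U (fun r => (r, 0))) => //.
    by move=> k u v; rewrite -[0 in LHS](addr0 0) -[X in (_, X + _)](scaler0 _ k).
  by move=> r; apply: (@cvg_pair _ _ _ (nbhs r) (nbhs r) (nbhs 0) _ _ _ id (fun=> 0)); [exact: cvg_id|exact: cvg_cst].
have h2 : Ck n U (fun x => (0 : F, g x)).
  apply: (@Ck_linpost _ G (F * G)%type n U (fun r => (0, r))) => //.
    by move=> k u v; rewrite -[0 in LHS](addr0 0) -[X in (X + _, _)](scaler0 _ k).
  by move=> r; apply: (@cvg_pair _ _ _ (nbhs r) (nbhs 0) (nbhs r) _ _ _ (fun=> 0) id); [exact: cvg_cst|exact: cvg_id].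
apply: Ck_ext (Ck_add oU h1 h2) => // x _.
by congr pair; [exact: addr0|exact: add0r].
Qed.

Lemma Ck_coord E n (U : set E) p r (f : E -> 'M[R]_(p, r)) i j : open U ->
  Ck n U f -> Ck n U (fun x => f x i j).
Proof.
move=> oU; apply: (@Ck_linpost _ 'M[R]_(p, r) R n U (fun M => M i j)) => //.
  by move=> k u v; rewrite !mxE.
exact: coord_continuous.
Qed.

Lemma Ck_mx E n (U : set E) p r (f : E -> 'M[R]_(p, r)) : open U ->
  (forall i j, Ck n U (fun x => f x i j)) -> Ck n U f.
Proof.
move=> oU Cf.
apply: (@Ck_ext _ _ _ _ (fun x => \sum_i \sum_j f x i j *: delta_mx i j)) => //.
  by move=> x _; rewrite -matrix_sum_delta.
apply: (Ck_sum oU) => i; apply: (Ck_sum oU) => j.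
apply: (@Ck_linpost _ R 'M[R]_(p, r) n U (fun c => c *: delta_mx i j)) => //.
  by move=> k u v; rewrite scalerDl scalerA.
exact: scalel_continuous.
Qed.

Lemma Ck_comp2 E n (U : set E) (V : set (R * R)) (f : R * R -> R) (g h : E -> R) :
  open U -> (forall x, U x -> V (g x, h x)) ->
  Ck n V f -> Ck n U g -> Ck n U h -> Ck n U (fun x => f (g x, h x)).
Proof.
move=> oU UV Cf Cg Ch.
pose b (i : 'I_2) : R * R := if i == ord0 then (1, 0) else (0, 1).
pose c (i : 'I_2) (p : R * R) : R := if i == ord0 then p.1 else p.2.
apply: (@Ck_comp _ (R * R)%type n 2 b c U V f (fun x => (g x, h x))) => //.
- by move=> i k u v; rewrite /c; case: (i == ord0).
- by move=> i; rewrite /c; case: (i == ord0) => p; [exact: cvg_fst|exact: cvg_snd].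
- move=> [x y]; rewrite big_ord_recl big_ord1 /b /c /=.
  by congr pair; rewrite /= /GRing.scale /= ?mulr1 ?mulr0 ?addr0 ?add0r.
- exact: Ck_pair.
Qed.

Lemma Ck_comp1 E n (U : set E) (V : set R) (f : R -> R) (g : E -> R) :
  open U -> (forall x, U x -> V (g x)) ->
  Ck n V f -> Ck n U g -> Ck n U (fun x => f (g x)).
Proof.
move=> oU UV Cf Cg.
apply: (@Ck_comp _ R n 1 (fun=> 1) (fun=> id) U V f g) => //.
- by move=> _ p; exact: cvg_id.
- by move=> w; rewrite big_ord1 /GRing.scale /= mulr1.
Qed.

End CkToolbox.

(** * Derivatives and primitives of real functions *)

Section RealCalculus.
Context {R : realType}.
Implicit Types (f g : R -> R) (a b t x : R).

(** In the rules below unification computes the derivative from the shape of the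
    function; [der_eq] then replaces it by the expected expression. *)
Lemma der_eq f x l m : is_derive x 1 f l -> l = m -> is_derive x 1 f m.
Proof. by move=> df <-. Qed.

Lemma derD f g x l m : is_derive x 1 f l -> is_derive x 1 g m ->
  is_derive x 1 (fun t => f t + g t) (l + m).
Proof. by move=> df dg; exact: is_deriveD. Qed.

Lemma derB f g x l m : is_derive x 1 f l -> is_derive x 1 g m ->
  is_derive x 1 (fun t => f t - g t) (l - m).
Proof. by move=> df dg; exact: is_deriveB. Qed.

Lemma derM f g x l m : is_derive x 1 f l -> is_derive x 1 g m ->
  is_derive x 1 (fun t => f t * g t) (l * g x + f x * m).
Proof.
by move=> df dg; apply: (der_eq (is_deriveM df dg)); rewrite /GRing.scale /= addrC (mulrC (g x)).
Qed.

Lemma der_cst (c x : R) : is_derive x 1 (fun _ : R => c) (0 : R).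
Proof. exact: is_derive_cst. Qed.

Lemma derZ (c : R) f x l : is_derive x 1 f l ->
  is_derive x 1 (fun t => c * f t) (c * l).
Proof.
by move=> df; apply: (der_eq (derM (der_cst c x) df)); rewrite mul0r add0r.
Qed.

Lemma derV f x l : f x != 0 -> is_derive x 1 f l ->
  is_derive x 1 (fun t => (f t)^-1) (- l / f x ^+ 2).
Proof.
move=> f0 [df <-]; apply: DeriveDef; first exact: derivableV.
by rewrite (deriveV f0 df) /GRing.scale /= mulNr mulrC mulNr.
Qed.

Lemma der_expR (k x : R) : is_derive x 1 (fun t => expR (k * t)) (k * expR (k * x)).
Proof.
have dkx : is_derive x 1 (fun t : R => k * t) k.
  by apply: (der_eq (derZ k (is_derive_id x 1))); rewrite mulr1.
by apply: (der_eq (is_derive1_comp (is_derive_expR (k * x)) dkx)); rewrite mulrC.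
Qed.

Lemma der_sum (I : finType) (h : I -> R -> R) x (l : I -> R) :
  (forall i, is_derive x 1 (h i) (l i)) ->
  is_derive x 1 (fun t => \sum_i h i t) (\sum_i l i).
Proof.
move=> H; elim: (index_enum I) => [|i s IH].
  rewrite big_nil; under eq_fun do rewrite big_nil; exact: der_cst.
rewrite big_cons; under eq_fun do rewrite big_cons; exact: derD.
Qed.

Lemma der_continuous f x l : is_derive x 1 f l -> {for x, continuous f}.
Proof.
by move=> [/derivable1_diffP df _]; exact: differentiable_continuous.
Qed.

Lemma within_cc f a b : (forall x, a <= x <= b -> {for x, continuous f}) ->
  {within `[a, b], continuous f}.
Proof.
by move=> cf; apply: continuous_in_subspaceT => x; rewrite inE /= in_itv /=; exact: cf.
Qed.

Lemma MVT_cc f (df : R -> R) a b : a <= b ->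
  (forall x, a <= x <= b -> is_derive x 1 f (df x)) ->
  exists2 c, a <= c <= b & f b - f a = df c * (b - a).
Proof.
move=> ab H.
have [||c] := @MVT_segment R f df a b ab.
- by move=> x; rewrite in_itv /= => /andP[ax xb]; apply: H; rewrite !ltW.
- by apply: within_cc => x /H; exact: der_continuous.
by rewrite in_itv /= => cab e; exists c.
Qed.

Lemma der_ge0_le f (df : R -> R) a b : a <= b ->
  (forall x, a <= x <= b -> is_derive x 1 f (df x)) ->
  (forall x, a <= x <= b -> 0 <= df x) -> f a <= f b.
Proof.
move=> ab H p; have [c cab e] := MVT_cc ab H.
by rewrite -subr_ge0 e mulr_ge0 ?p // subr_ge0.
Qed.

Lemma der0_cst f a b : a <= b ->
  (forall x, a <= x <= b -> is_derive x 1 f 0) -> f a = f b.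
Proof.
move=> ab H; have [c _] := MVT_cc ab H.
by rewrite mul0r => /eqP; rewrite subr_eq0 => /eqP ->.
Qed.

Lemma segment_bounded f a b : (forall x, a <= x <= b -> {for x, continuous f}) ->
  exists2 K, 0 <= K & forall x, a <= x <= b -> `|f x| <= K.
Proof.
move=> cf; have [ab|ab] := leP a b; last first.
  by exists 0 => // x /andP[ax xb]; move: (le_trans ax xb); rewrite leNgt ab.
have [|c _ Hc] := @EVT_max R (fun x => `|f x|) a b ab.
  apply: within_cc => x xab; apply: cvg_norm; exact: cf.
by exists `|f c| => // x xab; apply: Hc; rewrite in_itv.
Qed.

Lemma primitive_segment f (n : R) : 0 < n -> continuous f ->
  exists2 F : R -> R, F 0 = 0 & forall t, - n < t < n -> is_derive t 1 F (f t).
Proof.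
move=> n0 cf.
pose F x := (\int[@lebesgue_measure R]_(t in [set` `[- n, x]]) f t)%R.
have dF t : - n < t < n -> is_derive t 1 F (f t).
  move=> /andP[nt tn].
  have [|dF1 dF2] := @continuous_FTC1_closed R f (- n) t n tn _ nt (cf t).
    apply: continuous_compact_integrable; first exact: segment_compact.
    exact: continuous_subspaceT.
  apply: DeriveDef; first exact: dF1.
  by rewrite -derive1E; exact: dF2.
exists (fun x => F x - F 0); first by rewrite subrr.
by move=> t tn; apply: (der_eq (derB (dF t tn) (der_cst (F 0) t))); rewrite subr0.
Qed.

(** Integration gives primitives on the intervals ]-n-1, n+1[. Normalized at 0
    they coincide where both are defined, so they glue to one on the line. *)
Lemma primitive_exists f : continuous f ->
  exists F : R -> R, F 0 = 0 /\ forall t, is_derive t 1 F (f t).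
Proof.
move=> cf.
have /choice [P HP] (n : nat) : exists F : R -> R,
    F 0 = 0 /\ forall t, - (n.+1%:R) < t < n.+1%:R -> is_derive t 1 F (f t).
  by have [F ? ?] := @primitive_segment f n.+1%:R (ltr0Sn _ _) cf; exists F.
have glue m n t : (m <= n)%N -> - (m.+1%:R) < t < m.+1%:R -> P m t = P n t.
  move=> mn tm.
  have mnR : m.+1%:R <= n.+1%:R :> R by rewrite ler_nat ltnS.
  have H (s : R) : `|s| <= `|t| -> is_derive s 1 (fun s => P m s - P n s) 0.
    move=> st; have sm : - (m.+1%:R) < s < m.+1%:R.
      by rewrite -ltr_norml (le_lt_trans st) // ltr_norml.
    have sn : - (n.+1%:R) < s < n.+1%:R.
      by rewrite -ltr_norml (lt_le_trans _ mnR) // ltr_norml.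
    by apply: (der_eq (derB ((HP m).2 s sm) ((HP n).2 s sn))); rewrite subrr.
  have E0 : P m 0 - P n 0 = 0 by rewrite (HP m).1 (HP n).1 subrr.
  apply/eqP; rewrite -subr_eq0 -E0; apply/eqP.
  have [t0|t0] := leP 0 t.
    apply/esym; apply: (@der0_cst (fun s => P m s - P n s) 0 t t0) => s /andP[s0 st]; apply: H.
    by rewrite !ger0_norm.
  apply: (@der0_cst (fun s => P m s - P n s) t 0 (ltW t0)) => s /andP[s0 st]; apply: H.
  by rewrite !ler0_norm ?lerN2 // ltW.
(* the value at x is read in an interval that depends on x; near a point t the
   single interval of index N t + 1 serves for all x *)
pose N x := Num.truncn `|x|.
have HN x : - ((N x).+1%:R) < x < (N x).+1%:R.
  by rewrite -ltr_norml /N truncnS_gt.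
exists (fun x => P (N x) x); split; first by rewrite (HP _).1.
move=> t.
have [tl tr] := andP (HN t).
apply: (near_eq_is_derive (f := P (N t).+1)); last first.
  apply: (HP (N t).+1).2; rewrite -ltr_norml.
  by apply: lt_trans (_ : (N t).+1%:R < _); [rewrite ltr_norml HN|rewrite ltr_nat].
have ot : open [set s : R | s < (N t).+1%:R /\ - (N t).+1%:R < s].
  by apply: openI; [exact: open_lt|exact: open_gt].
apply: filterS (open_nbhs_nbhs (conj ot (conj tr tl))) => s [sr sl].
have Ns : (N s <= (N t).+1)%N.
  rewrite leqW // /N.
  have : `|s| < (N t).+1%:R by rewrite ltr_norml sl.
  by rewrite truncn_le_nat.
by rewrite (glue _ _ _ Ns (HN s)).
Qed.

End RealCalculus.

(** * Existence for linear differential equations *)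

Section LinearODE.
Context {R : realType}.
Implicit Types (a b t : R).

(** The sequences [v k - 2 D / 2 ^+ k] and [v k + 2 D / 2 ^+ k] are respectively
    nondecreasing and nonincreasing, and the limit is the supremum of the first.
    The explicit rate makes the convergence uniform in parameters of [v]. *)
Lemma geometric_cauchy_limit (v : nat -> R) (D : R) : 0 <= D ->
  (forall k, `|v k.+1 - v k| <= D / 2 ^+ k) ->
  exists l, forall k, `|l - v k| <= 2 * D / 2 ^+ k.
Proof.
move=> D0 H.
pose lo k := v k - 2 * D / 2 ^+ k; pose up k := v k + 2 * D / 2 ^+ k.
have halve k : 2 * D / 2 ^+ k.+1 = D / 2 ^+ k by rewrite exprS; field.
have loS k : lo k <= lo k.+1.
  rewrite /lo halve; have := H k; rewrite ler_norml => /andP[h _].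
  have -> : 2 * D / 2 ^+ k = 2 * (D / 2 ^+ k) by rewrite mulrA.
  by lra.
have upS k : up k.+1 <= up k.
  rewrite /up halve; have := H k; rewrite ler_norml => /andP[_ h].
  have -> : 2 * D / 2 ^+ k = 2 * (D / 2 ^+ k) by rewrite mulrA.
  by lra.
have lo_mono := homo_leq (@lexx _ R) (@le_trans _ R) loS.
have up_mono := homo_leq (@lexx _ R) (fun y x z (h : y <= x) k => le_trans k h : z <= x) upS.
have loup j k : lo j <= up k.
  apply: (@le_trans _ _ (lo (maxn j k))); first by apply: lo_mono; rewrite leq_maxl.
  apply: (@le_trans _ _ (up (maxn j k))); last by apply: up_mono; rewrite leq_maxr.
  rewrite /lo /up; have : 0 <= 2 * D / 2 ^+ maxn j k.
    by rewrite divr_ge0 ?exprn_ge0 // mulr_ge0.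
  by lra.
pose S := [set lo k | k in setT].
exists (sup S) => k.
have ubS : has_ubound S by exists (up 0%N) => _ [j _ <-].
have h1 : lo k <= sup S by apply: ub_le_sup => //; exists k.
have h2 : sup S <= up k.
  by apply: ge_sup; [exists (lo 0%N); exists 0%N|move=> _ [j _ <-]].
by rewrite ler_norml; move: h1 h2; rewrite /lo /up => h1 h2; apply/andP; split; lra.
Qed.

Lemma geometric_small (D e : R) : 0 < e -> exists k, D / 2 ^+ k < e.
Proof.
move=> e0; exists (Num.truncn (D / e)).+1.
have h : D / e < (Num.truncn (D / e)).+1%:R by exact: truncnS_gt.
rewrite ltr_pdivrMr ?exprn_gt0 // mulrC -ltr_pdivrMr //.
apply: (lt_le_trans h); rewrite -natrX ler_nat.
by apply: ltnW; exact: ltn_expl.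
Qed.

(** Integrating from 0 divides the norm weighted by exp(-L|t|) by [L]; for large
    [L] this turns Picard's map into a contraction on the whole line. *)
Lemma exp_growth_bound (F dF : R -> R) (C L : R) : 0 < L -> 0 <= C ->
  F 0 = 0 -> (forall t, is_derive t 1 F (dF t)) ->
  (forall t, `|dF t| <= C * expR (L * `|t|)) ->
  forall t, `|F t| <= C / L * expR (L * `|t|).
Proof.
move=> L0 C0 F0 HF HB.
have CL : 0 <= C / L by rewrite divr_ge0 // ltW.
move=> t; have [t0|t0] := leP 0 t.
  have key (sg : R) : (forall s, `|sg * dF s| <= `|dF s|) -> sg * F t <= C / L * expR (L * t).
    move=> hsg.
    have dG (s : R) : is_derive s 1 (fun s => C / L * expR (L * s) - sg * F s)
        (C / L * (L * expR (L * s)) - sg * dF s).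
      exact: (derB (derZ (C / L) (der_expR L s)) (derZ sg (HF s))).
    have := der_ge0_le t0 (fun s _ => dG s).
    rewrite mulr0 expR0 F0 mulr0 mulr1 subr0 => h.
    have {h} : C / L <= C / L * expR (L * t) - sg * F t.
      apply: h => s /andP[s0 _].
      have -> : C / L * (L * expR (L * s)) = C * expR (L * s).
        by rewrite mulrA divfK // gt_eqF.
      have := HB s; rewrite (ger0_norm s0); have := hsg s; rewrite subr_ge0.
      by move=> h1 h2; rewrite (le_trans (ler_norm _)) // (le_trans h1).
    by lra.
  rewrite ler_norml (ger0_norm t0); apply/andP; split.
    by rewrite lerNl -(mulN1r (F t)); apply: key => s; rewrite mulN1r normrN.
  by rewrite -[F t]mul1r; apply: key => s; rewrite mul1r.
have key (sg : R) : (forall s, `|sg * dF s| <= `|dF s|) -> sg * F t <= C / L * expR (- L * t).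
  move=> hsg.
  have dG (s : R) : is_derive s 1 (fun s => sg * F s - C / L * expR (- L * s))
      (sg * dF s - C / L * (- L * expR (- L * s))).
    exact: (derB (derZ sg (HF s)) (derZ (C / L) (der_expR (- L) s))).
  have := der_ge0_le (ltW t0) (fun s _ => dG s).
  rewrite mulr0 expR0 F0 mulr0 mulr1 sub0r => h.
  have {h} : sg * F t - C / L * expR (- L * t) <= - (C / L).
    apply: h => s /andP[_ s0].
    have -> : C / L * (- L * expR (- L * s)) = - (C * expR (- L * s)).
      by rewrite mulrA mulrN divfK ?mulNr // gt_eqF.
    have := HB s; rewrite (ler0_norm s0) mulrN -mulNr; have := hsg s.
    move=> h1 h2; have := le_trans h1 h2; rewrite ler_norml => /andP[h3 _].
    by rewrite opprK -lerBlDr sub0r.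
  by lra.
rewrite (ltr0_norm t0) mulrN -mulNr ler_norml; apply/andP; split.
  by rewrite lerNl -(mulN1r (F t)); apply: key => s; rewrite mulN1r normrN.
by rewrite -[F t]mul1r; apply: key => s; rewrite mul1r.
Qed.

(** Right-hand side of the system y' = y X for a row vector y. Indexing by an
    arbitrary finite type allows systems indexed by a sum [I + I]. *)
Definition ode_field (I : finType) (X : I -> I -> R -> R) (y : I -> R -> R) j t : R :=
  \sum_i y i t * X i j t.

Definition ode_solution (I : finType) (X : I -> I -> R -> R) a b
    (y : I -> R -> R) :=
  forall j t, a <= t <= b -> is_derive t 1 (y j) (ode_field X y j t).

(** Picard iteration. With the weight exp(L|t|), L = 2 (#|I| K + 1), each step
    halves the distance between two iterates. *)
Lemma picard_global (I : finType) (X : I -> I -> R -> R) (K : R) (c : I -> R) :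
  0 <= K -> (forall i j, continuous (X i j)) ->
  (forall i j t, `|X i j t| <= K) ->
  exists y : I -> R -> R, (forall j, y j 0 = c j) /\
    forall j t, is_derive t 1 (y j) (ode_field X y j t).
Proof.
move=> K0 cX KX.
have cf (y : I -> R -> R) j : (forall i, continuous (y i)) -> continuous (ode_field X y j).
  move=> cy t; rewrite /ode_field.
  elim: (index_enum I) => [|i s IH].
    by under eq_fun do rewrite big_nil; exact: cst_continuous.
  under eq_fun do rewrite big_cons.
  by apply: (@cvgD _ _ _ _ _ (fun t => y i t * X i j t)) => //; apply: cvgM; [exact: cy|exact: cX].
have [prim Hp] : exists P : (R -> R) -> R -> R, forall f, continuous f ->
    P f 0 = 0 /\ forall t, is_derive t 1 (P f) (f t).
  have /choice [P HP] (f : R -> R) : exists F : R -> R, continuous f ->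
      F 0 = 0 /\ forall t, is_derive t 1 F (f t).
    have [cf'|ncf] := pselect (continuous f); last by exists (fun=> 0) => /ncf.
    by have [F ?] := primitive_exists cf'; exists F.
  by exists P.
pose T (y : I -> R -> R) j t := c j + prim (ode_field X y j) t.
have dT (y : I -> R -> R) j t : (forall i, continuous (y i)) ->
    is_derive t 1 (T y j) (ode_field X y j t).
  move=> cy; apply: (der_eq (derD (der_cst (c j) t) ((Hp _ (cf _ _ cy)).2 t))).
  by rewrite add0r.
have T0 (y : I -> R -> R) j : (forall i, continuous (y i)) -> T y j 0 = c j.
  by move=> cy; rewrite /T (Hp _ (cf _ _ cy)).1 addr0.
pose N : R := #|I|%:R.
pose L : R := 2 * (N * K + 1).
have N0 : 0 <= N by rewrite ler0n.
have NK0 : 0 <= N * K by rewrite mulr_ge0.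
have L0 : 0 < L by rewrite /L; lra.
have cT (y : I -> R -> R) : (forall i, continuous (y i)) -> forall i, continuous (T y i).
  by move=> cy i t; exact: der_continuous (dT y i t cy).
(* integration gains a factor 1 / L and the sum over i costs N K, less than L / 2 *)
have contr (y z : I -> R -> R) (C : R) : 0 <= C ->
    (forall i, continuous (y i)) -> (forall i, continuous (z i)) ->
    (forall i t, `|y i t - z i t| <= C * expR (L * `|t|)) ->
    forall j t, `|T y j t - T z j t| <= C / 2 * expR (L * `|t|).
  move=> C0 cy cz H j.
  have dB t : is_derive t 1 (fun t => T y j t - T z j t)
      (ode_field X y j t - ode_field X z j t).
    exact: (derB (dT y j t cy) (dT z j t cz)).
  have h0 : T y j 0 - T z j 0 = 0 by rewrite !T0 // subrr.
  have hB t : `|ode_field X y j t - ode_field X z j t| <= (N * K * C) * expR (L * `|t|).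
    rewrite /ode_field -sumrB (le_trans (ler_norm_sum _ _ _)) //.
    apply: (@le_trans _ _ (\sum_(i : I) (K * C) * expR (L * `|t|))).
      apply: ler_sum => i _; rewrite -mulrBl normrM mulrC -mulrA.
      by apply: ler_pM => //; exact: KX.
    by rewrite sumr_const -mulr_natl !mulrA.
  have hNKC : 0 <= N * K * C by rewrite mulr_ge0.
  move=> t; have h := @exp_growth_bound _ _ _ _ L0 hNKC h0 dB hB t.
  apply: (le_trans h); apply: ler_wpM2r; first exact: expR_ge0.
  rewrite ler_pdivrMr //.
  have -> : C / 2 * L = (N * K + 1) * C by rewrite /L; field.
  by apply: ler_wpM2r => //; lra.
pose u k := iter k T (fun j _ => c j).
have uc k i : continuous (u k i).
  by elim: k i => [i|k IH i]; [exact: cst_continuous|apply: cT].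
have [C C0 u1] : exists2 C : R, 0 <= C & forall j t, `|u 1%N j t - u 0%N j t| <= C * expR (L * `|t|).
  pose B := \sum_i `|c i|.
  have B0 : 0 <= B by apply: sumr_ge0 => i _.
  exists (B * K / L); first by apply: divr_ge0; [exact: mulr_ge0|exact: ltW].
  move=> j.
  apply: (@exp_growth_bound (fun t => u 1%N j t - u 0%N j t) (ode_field X (u 0%N) j) (B * K) L L0).
  - by rewrite mulr_ge0.
  - by rewrite /u /= T0 ?subrr // => i; exact: cst_continuous.
  - move=> t; apply: (der_eq (derB (dT _ j t (uc 0%N)) (der_cst (c j) t))).
    by rewrite subr0.
  move=> t; apply: (@le_trans _ _ (B * K)); last first.
    by rewrite ler_peMr ?mulr_ge0 // -expR0 ler_expR mulr_ge0 // ltW.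
  rewrite /ode_field (le_trans (ler_norm_sum _ _ _)) // mulr_suml.
  apply: ler_sum => i _; rewrite normrM; exact: ler_wpM2l (KX i j t).
have ustep k j t : `|u k.+1 j t - u k j t| <= C / 2 ^+ k * expR (L * `|t|).
  elim: k j t => [|k IH] j t; first by rewrite expr0 divr1.
  have hC : 0 <= C / 2 ^+ k by rewrite divr_ge0 // exprn_ge0.
  have := contr _ _ _ hC (uc k.+1) (uc k) IH j t.
  have -> : C / 2 ^+ k.+1 = C / 2 ^+ k / 2 by rewrite exprS invfM mulrA mulrAC.
  by [].
have /choice [y0 Hy0] (p : I * R) : exists l : R, forall k,
    `|l - u k p.1 p.2| <= 2 * (C * expR (L * `|p.2|)) / 2 ^+ k.
  apply: geometric_cauchy_limit; first by rewrite mulr_ge0 // expR_ge0.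
  by move=> k; rewrite mulrAC; exact: ustep.
pose y j t := y0 (j, t).
have yu k j t : `|y j t - u k j t| <= 2 * C / 2 ^+ k * expR (L * `|t|).
  apply: (le_trans (Hy0 (j, t) k)); rewrite /=.
  by rewrite le_eqVlt; apply/orP; left; apply/eqP; ring.
have cy j : continuous (y j).
  move=> t; apply/cvgrPdist_lt => e e0.
  pose W := expR (L * (`|t| + 1)).
  have W0 : 0 <= W by exact: expR_ge0.
  have e4 : 0 < e / 4 by lra.
  have [k hk] := geometric_small (2 * C * W) e4.
  have small s : `|s| <= `|t| + 1 -> `|y j s - u k j s| < e / 4.
    move=> hs; apply: le_lt_trans (yu k j s) _; apply: le_lt_trans hk.
    rewrite mulrAC; apply: ler_wpM2r; first by rewrite invr_ge0 exprn_ge0.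
    apply: ler_wpM2l; first by rewrite mulr_ge0.
    by rewrite ler_expR; apply: ler_wpM2l => //; exact: ltW.
  have := uc k j t => /cvgrPdist_lt /(_ _ e4) cu.
  near=> s.
  have st : `|s| <= `|t| + 1.
    have : `|t - s| < 1 by near: s; have := @cvg_id _ (nbhs t) => /cvgrPdist_lt; apply; exact: ltr01.
    by move=> h; rewrite -[s](subrK t) addrC (le_trans (ler_normD _ _)) // lerD2l distrC ltW.
  have h1 := small t (ltac:(by rewrite lerDl)).
  have h2 := small s st.
  have h3 : `|u k j t - u k j s| < e / 4 by near: s.
  move: h1 h2 h3; rewrite !ltr_norml => /andP[? ?] /andP[? ?] /andP[? ?].
  by apply/andP; split; lra.
have yT j t : y j t = T y j t.
  apply/eqP; rewrite -subr_eq0 -normr_le0; apply/ler_addgt0Pr => e e0; rewrite add0r.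
  pose W := expR (L * `|t|).
  have W0 : 0 <= W by exact: expR_ge0.
  have e2 : 0 < e / 2 by lra.
  have [k hk] := geometric_small (2 * C * W) e2.
  have hC : 0 <= 2 * C / 2 ^+ k by rewrite divr_ge0 ?exprn_ge0 // mulr_ge0.
  have h1 := contr _ _ _ hC cy (uc k) (yu k) j t.
  have h2 := yu k.+1 j t.
  have E1 : 2 * C / 2 ^+ k.+1 = 2 * C / 2 ^+ k / 2 by rewrite exprS; field.
  have E2 : 2 * C * W / 2 ^+ k = 2 * C / 2 ^+ k * W by rewrite mulrAC.
  rewrite E2 in hk; rewrite E1 in h2.
  have -> : y j t - T y j t = (y j t - u k.+1 j t) - (T y j t - T (u k) j t).
    by rewrite /u /=; ring.
  apply: (le_trans (ler_normB _ _)).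
  rewrite -/W in h1 h2.
  have -> : e = e / 2 + e / 2 by lra.
  by apply: lerD; [apply: (le_trans h2)|apply: (le_trans h1)]; lra.
exists y; split=> [j|j t]; first by rewrite yT T0.
have -> : y j = T y j by apply/funext => s; exact: yT.
exact: dT.
Unshelve. all: by end_near. Qed.

Lemma family_segment_bounded (I J : finType) (X : I -> J -> R -> R) a b :
  (forall i j t, a <= t <= b -> {for t, continuous (X i j)}) ->
  exists2 K, 0 <= K & forall i j t, a <= t <= b -> `|X i j t| <= K.
Proof.
move=> cX.
have /choice [k Hk] (p : I * J) : exists K : R, 0 <= K /\
    forall t, a <= t <= b -> `|X p.1 p.2 t| <= K.
  by have [K ? ?] := segment_bounded (cX p.1 p.2); exists K.
exists (\sum_p k p); first by apply: sumr_ge0 => p _; exact: (Hk p).1.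
move=> i j t tab; apply: (le_trans ((Hk (i, j)).2 t tab)).
by rewrite (bigD1 (i, j)) //= lerDl; apply: sumr_ge0 => p _; exact: (Hk p).1.
Qed.

(** Clamping the time to [a, b] gives bounded continuous coefficients on the
    line, and does not change the equation on [a, b]. *)
Lemma ode_exists (I : finType) (X : I -> I -> R -> R) (c : I -> R) a b :
  a <= b ->
  (forall i j t, a <= t <= b -> {for t, continuous (X i j)}) ->
  exists y : I -> R -> R, (forall j, y j 0 = c j) /\ ode_solution X a b y.
Proof.
move=> ab cX.
pose phi (t : R) := Num.max a (Num.min t b).
have phi_ab t : a <= phi t <= b.
  by rewrite /phi le_max lexx /= ge_max ab /= ge_min lexx orbT.
have phiE t : a <= t <= b -> phi t = t.
  by move=> /andP[at_ tb]; rewrite /phi (min_idPl tb) (max_idPr at_).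
have cphi : continuous phi.
  move=> t; apply: (@continuous_max R R (fun=> a) (fun t => Num.min t b)); first exact: cvg_cst.
  by apply: (@continuous_min R R id (fun=> b)); [exact: cvg_id|exact: cvg_cst].
have [K K0 HK] := family_segment_bounded cX.
have [||y [y0 Hy]] := @picard_global I (fun i j t => X i j (phi t)) K c K0.
- by move=> i j t; apply: (cvg_comp _ _ (cphi t)); exact: cX.
- by move=> i j t; exact: HK.
exists y; split=> // j t tab; apply: (der_eq (Hy j t)).
by apply: eq_bigr => i _; rewrite phiE.
Qed.

End LinearODE.

(** * Functions of time and a parameter *)

Section TwoVariables.
Context {R : realType}.
Implicit Types (a b t : R).

Lemma near_planeP (p : R * R) (P : R * R -> Prop) :
  (\forall q \near p, P q) <->
  exists2 r : R, 0 < r & forall q : R * R, `|q.1 - p.1| < r -> `|q.2 - p.2| < r -> P q.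
Proof.
split=> [/nbhs_ballP[r /= r0 H]|[r r0 H]].
  by exists r => // q h1 h2; apply: H; split; rewrite /ball /= distrC.
apply/nbhs_ballP; exists r => //= q [h1 h2].
by apply: H; rewrite distrC.
Qed.

Lemma MVT_increment (f df : R -> R) (x h : R) :
  (forall s : R, `|s| <= `|h| -> is_derive (x + s) 1 f (df (x + s))) ->
  exists2 s, `|s| <= `|h| & f (x + h) - f x = df (x + s) * h.
Proof.
move=> H; have [h0|h0] := leP 0 h.
  have xh : x <= x + h by lra.
  have [|c /andP[c1 c2] e] := @MVT_cc _ f df _ _ xh.
    move=> z /andP[z1 z2]; have -> : z = x + (z - x) by ring.
    by apply: H; rewrite !ger0_norm; lra.
  exists (c - x); first by rewrite !ger0_norm; lra.
  by rewrite e; congr (df _ * _); ring.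
have xh : x + h <= x by lra.
have [|c /andP[c1 c2] e] := @MVT_cc _ f df _ _ xh.
  move=> z /andP[z1 z2]; have -> : z = x + (z - x) by ring.
  by apply: H; rewrite !ler0_norm; lra.
exists (c - x); first by rewrite !ler0_norm; lra.
by rewrite -opprB e subrKC; ring.
Qed.

(** The increment is split into a horizontal and a vertical one. The first is
    controlled by the mean value theorem and the continuity of the partial
    derivative [ft], the second by differentiability at the single point [p]. *)
Lemma frechet_partials (f ft : R * R -> R) (p : R * R) (e : R) :
  (\forall q \near p, is_derive (q.1 : R) 1 (fun s : R => f (s, q.2)) (ft q)) ->
  {for p, continuous ft} ->
  is_derive (p.2 : R) 1 (fun s : R => f (p.1, s)) e ->
  differentiable f p /\ forall v, 'D_v f p = v.1 * ft p + v.2 * e.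
Proof.
move=> dt ct de.
pose L (h : R * R) : R^o := h.1 * ft p + h.2 * e.
have lL : linear L by move=> k [u1 u2] [v1 v2]; rewrite /L /= /GRing.scale /= !mulrDl mulrDr !mulrA addrACA.
pose L' : {linear (R * R)%type -> R^o} := HB.pack L (GRing.isLinear.Build _ _ _ _ L lL).
have cL : continuous (L' : R * R -> R).
  move=> u; apply: (@cvgD _ _ _ _ _ (fun h : R * R => h.1 * ft p)).
    by apply: cvgM; [exact: cvg_fst|exact: cvg_cst].
  by apply: cvgM; [exact: cvg_snd|exact: cvg_cst].
have [|df dE] := @differentiable_eps R (R * R)%type R f p L' cL.
  move=> eps eps0; have eps2 : 0 < eps / 2 by lra.
  have [r1 r10 H1] := (near_planeP _ _).1 dt.
  have [r2 r20 H2] : exists2 r : R, 0 < r & forall q : R * R, `|q.1 - p.1| < r -> `|q.2 - p.2| < r -> `|ft p - ft q| < eps / 2.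
    by apply/near_planeP; move/cvgrPdist_lt: ct; apply.
  have [r3 r30 H3] : exists2 r : R, 0 < r & forall h : R, `|h| < r ->
      `|f (p.1, h + p.2) - f p - h * e| <= eps / 2 * `|h|.
    have [dd De] := de.
    have /derivable_nbhs/eqaddoP /(_ _ eps2) /nbhs_ballP [r /= r0 H] := dd.
    exists r => // h hr; have := H h; rewrite /ball /= sub0r normrN => /(_ hr).
    by rewrite !fctE /= De opprD addrA /GRing.scale /= mulr1 -surjective_pairing.
  pose r := Num.min r1 (Num.min r2 r3).
  apply/nbhs_ballP; exists r; first by rewrite /= /r !lt_min r10 r20 r30.
  move=> h [/= hb1 hb2].
  have [h1 h2] : `|h.1| < r /\ `|h.2| < r.
    by move: hb1 hb2; rewrite /ball /= !sub0r !normrN.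
  move: h1 h2; rewrite /r !lt_min => /and3P[h11 h12 h13] /and3P[h21 h22 h23].
  have [|s sh Es] := @MVT_increment (fun s => f (s, h.2 + p.2)) (fun s => ft (s, h.2 + p.2)) p.1 h.1.
    move=> s sh; apply: (H1 (p.1 + s, h.2 + p.2)); rewrite /=.
      by rewrite addrC addKr (le_lt_trans sh).
    by rewrite addrK.
  have hn1 : `|h.1| <= `|h| by rewrite prod_normE le_max lexx.
  have hn2 : `|h.2| <= `|h| by rewrite prod_normE le_max lexx orbT.
  have A2 := H3 h.2 h23.
  have A1 : `|ft p - ft (p.1 + s, h.2 + p.2)| < eps / 2.
    apply: H2; rewrite /= ?addrK // addrC addKr; exact: le_lt_trans sh _.
  have -> : f (h + p) - f p - L' h =
      - ((ft p - ft (p.1 + s, h.2 + p.2)) * h.1) + (f (p.1, h.2 + p.2) - f p - h.2 * e).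
    have -> : h + p = (p.1 + h.1, h.2 + p.2) by rewrite [p.1 + _]addrC; case: (h) (p) => [? ?] [? ?].
    have {}Es : f (p.1 + h.1, h.2 + p.2) = ft (p.1 + s, h.2 + p.2) * h.1 + f (p.1, h.2 + p.2).
      by rewrite -Es subrK.
    by rewrite Es /L' /= /L; ring.
  apply: (le_trans (ler_normD _ _)); rewrite normrN normrM.
  have -> : eps * `|h| = eps / 2 * `|h| + eps / 2 * `|h| by field.
  apply: lerD; last by apply: (le_trans A2); apply: ler_wpM2l => //; exact: ltW.
  by apply: ler_pM => //; exact: ltW.
split=> // v; rewrite deriveE //; exact: dE.
Qed.

Lemma derive_snd (f : R * R -> R) (p : R * R) l :
  is_derive p (0, 1) f l -> is_derive (p.2 : R) 1 (fun s : R => f (p.1, s)) l.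
Proof.
have E : (fun h : R => h^-1 *: ((f \o shift p) (h *: (0, 1)) - f p)) =
    (fun h : R => h^-1 *: (((fun s => f (p.1, s)) \o shift p.2) (h *: 1) - f (p.1, p.2))).
  apply/funext => h /=; rewrite -surjective_pairing; congr (_ *: (f _ - _)).
  by case: (p) => p1 p2; congr pair; rewrite /= ?scaler0 ?add0r.
move=> [dv Dv]; split.
  by rewrite /derivable -E.
by rewrite -Dv /derive -E.
Qed.

(** By compactness of the segment, continuity in the parameter is uniform in
    time. *)
Lemma uniform_on_segment (g : R * R -> R) a b (x d : R) :
  (forall t, a <= t <= b -> {for (t, x), continuous g}) -> 0 < d ->
  exists2 r : R, 0 < r & forall t h, a <= t <= b -> `|h| < r ->
    `|g (t, x + h) - g (t, x)| <= d.
Proof.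
move=> cg d0; have d2 : 0 < d / 2 by lra.
have K := (@compact_near_coveringP _ _).1 (@segment_compact R a b).
have /nbhs_ballP [r /= r0 Hr] : \forall h \near (0 : R), `[a, b]%classic `<=`
    (fun t => `|g (t, x + h) - g (t, x)| <= d).
  apply: (K R (nbhs (0 : R)) (fun h t => `|g (t, x + h) - g (t, x)| <= d)) => t; rewrite /= in_itv /= => tab.
  have [r r0 H] : exists2 r : R, 0 < r & forall q : R * R, `|q.1 - t| < r -> `|q.2 - x| < r ->
      `|g (t, x) - g q| < d / 2.
    by apply/(near_planeP (t, x)); move/cvgrPdist_lt: (cg t tab); apply.
  exists (ball t r, ball (0 : R) r); first by split; exact: nbhsx_ballx.
  move=> [s h] [/=]; rewrite /ball /= sub0r normrN => sb hb.
  have h1 : `|g (t, x) - g (s, x + h)| < d / 2.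
    by apply: H => /=; [rewrite distrC|rewrite addrC addKr].
  have h2 : `|g (t, x) - g (s, x)| < d / 2.
    by apply: H => /=; [rewrite distrC|rewrite subrr normr0].
  move: h1 h2; rewrite !ltr_norml => /andP[? ?] /andP[? ?].
  by rewrite ler_norml; apply/andP; split; lra.
exists r => // t h tab hr; apply: (Hr h) => /=; last by rewrite in_itv.
by rewrite /ball /= sub0r normrN.
Qed.

End TwoVariables.

(** * Continuous dependence on the coefficients *)

Section ContinuousDependence.
Context {R : realType}.
Implicit Types (a b t : R).

(** The quantity (E + c / L) exp(-L|t|) does not increase when t moves away from
    0, in either direction. *)
Lemma gronwall (E dE : R -> R) (L c a b : R) : 0 < L -> 0 <= c -> E 0 = 0 ->
  (forall t, a <= t <= b -> is_derive t 1 E (dE t)) ->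
  (forall t, a <= t <= b -> `|dE t| <= L * E t + c) ->
  a <= 0 <= b -> forall t, a <= t <= b -> E t <= c / L * expR (L * `|t|).
Proof.
move=> L0 c0 E0 HE HB /andP[a0 b0] t /andP[ta tb].
have cL : 0 <= c / L by rewrite divr_ge0 // ltW.
have dG (s k : R) : a <= s <= b -> is_derive s 1 (fun s => (E s + c / L) * expR (k * s))
    ((dE s + k * (E s + c / L)) * expR (k * s)).
  move=> sab; apply: (der_eq (derM (derD (HE s sab) (der_cst (c / L) s)) (der_expR k s))).
  by ring.
have Lc : L * (c / L) = c by rewrite mulrC divfK // gt_eqF.
suff H : E t + c / L <= c / L * expR (L * `|t|) by lra.
have [t0|t0] := leP 0 t.
  rewrite (ger0_norm t0) -ler_pdivrMr ?expR_gt0 // -expRN -mulNr.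
  have := @der_ge0_le _ (fun s => - ((E s + c / L) * expR (- L * s)))
     (fun s => - ((dE s + - L * (E s + c / L)) * expR (- L * s))) 0 t t0.
  rewrite mulr0 expR0 mulr1 E0 add0r lerN2; apply.
    move=> s /andP[s0 st]; have sab : a <= s <= b by lra.
    by have := derZ (-1) (dG s (- L) sab); under eq_fun do rewrite mulN1r; rewrite mulN1r.
  move=> s /andP[s0 st]; have sab : a <= s <= b by lra.
  have := HB s sab; rewrite ler_norml => /andP[_ h].
  rewrite -mulNr mulr_ge0 ?expR_ge0 //; lra.
rewrite (ltr0_norm t0) mulrN -mulNr -ler_pdivrMr ?expR_gt0 // -expRN mulNr opprK.
have := @der_ge0_le _ (fun s => ((E s + c / L) * expR (L * s)))
   (fun s => ((dE s + L * (E s + c / L)) * expR (L * s))) t 0 (ltW t0).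
rewrite mulr0 expR0 mulr1 E0 add0r; apply.
  by move=> s /andP[s0 st]; apply: dG; lra.
move=> s /andP[s0 st]; have sab : a <= s <= b by lra.
have := HB s sab; rewrite ler_norml => /andP[h _].
rewrite mulr_ge0 ?expR_ge0 //; lra.
Qed.

Lemma sum_cst (I : finType) (x : R) : \sum_(i : I) x = #|I|%:R * x.
Proof. by rewrite sumr_const [in RHS]mulr_natl. Qed.

(** Gronwall's inequality for the energy |z - y|^2. The tolerance [d] depends on
    neither of [Y] and [z]; so the estimate applies to systems obtained by moving
    a parameter, and also to the systems satisfied by difference quotients. *)
Lemma ode_continuous_dependence (I : finType) (X : I -> I -> R -> R)
    (y : I -> R -> R) a b :
  a <= 0 <= b ->
  (forall i j t, a <= t <= b -> {for t, continuous (X i j)}) ->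
  ode_solution X a b y ->
  forall eta, 0 < eta -> exists2 d : R, 0 < d &
  forall (Y : I -> I -> R -> R) (z : I -> R -> R),
    (forall i j t, a <= t <= b -> `|Y i j t - X i j t| <= d) ->
    ode_solution Y a b z -> (forall j, z j 0 = y j 0) ->
    forall j t, a <= t <= b -> `|z j t - y j t| <= eta.
Proof.
move=> ab0 cX Hy eta eta0; have /andP[a0 b0] := ab0.
have [K K0 HK] := family_segment_bounded cX.
have [C C0 HC] : exists2 C, 0 <= C & forall i t, a <= t <= b -> `|y i t| <= C.
  have [|C C0 HC] := @family_segment_bounded R I unit (fun i _ => y i) a b.
    by move=> i _ t tab; exact: der_continuous (Hy i t tab).
  by exists C => // i t; exact: (HC i tt).
pose N : R := #|I|%:R; have N0 : 0 <= N by exact: ler0n.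
pose L : R := 2 * N * (K + 1) + N + 1.
have NK : 0 <= N * K by exact: mulr_ge0.
have L0 : 0 < L by rewrite /L; lra.
pose D : R := N ^+ 2 * C ^+ 2 / L * expR (L * (b - a)).
have D0 : 0 <= D.
  apply: mulr_ge0; last exact: expR_ge0.
  by apply: divr_ge0; [apply: mulr_ge0; exact: sqr_ge0|exact: ltW].
(* with this choice d^2 D <= eta^2; also d <= 1 bounds Y by K + 1 *)
pose d := Num.min 1 (eta / (D + 1)).
have d0 : 0 < d by rewrite /d lt_min ltr01 divr_gt0 //; lra.
have d1 : d <= 1 by rewrite /d ge_min lexx.
have dD : d ^+ 2 * D <= eta ^+ 2.
  have h1 : d <= eta / (D + 1) by rewrite /d ge_min lexx orbT.
  have h2 : d * (D + 1) <= eta by rewrite -ler_pdivlMr //; lra.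
  have h3 : (d * (D + 1)) ^+ 2 <= eta ^+ 2.
    rewrite ler_pXn2r ?nnegrE //; last exact: ltW.
    by apply: mulr_ge0; lra.
  apply: le_trans h3; rewrite exprMn; apply: ler_wpM2l; first exact: sqr_ge0.
  by nra.
exists d => // Y z HY Hz z0.
pose u j t := z j t - y j t.
pose du j t := \sum_i (u i t * Y i j t + y i t * (Y i j t - X i j t)).
have Hu j t : a <= t <= b -> is_derive t 1 (u j) (du j t).
  move=> tab; apply: (der_eq (derB (Hz j t tab) (Hy j t tab))).
  rewrite /ode_field /du -sumrB; apply: eq_bigr => i _; rewrite /u; ring.
pose E t := \sum_j u j t * u j t.
have E0 : E 0 = 0 by rewrite /E big1 // => j _; rewrite /u z0 subrr mul0r.
have HE t : a <= t <= b -> is_derive t 1 E (\sum_j (du j t * u j t + u j t * du j t)).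
  by move=> tab; apply: der_sum => j; apply: derM; exact: Hu.
have uE j t : u j t * u j t <= E t.
  rewrite /E (bigD1 j) //= lerDl; apply: sumr_ge0 => i _.
  by rewrite -expr2 sqr_ge0.
pose c := N ^+ 2 * (C ^+ 2 * d ^+ 2).
have c0 : 0 <= c by apply: mulr_ge0; [exact: sqr_ge0|apply: mulr_ge0; exact: sqr_ge0].
have HB t : a <= t <= b -> `|\sum_j (du j t * u j t + u j t * du j t)| <= L * E t + c.
  move=> tab.
  have term i j : `|u i t * Y i j t + y i t * (Y i j t - X i j t)| * (2 * `|u j t|) <=
      (u i t * u i t + u j t * u j t) * (K + 1) + (u j t * u j t + C ^+ 2 * d ^+ 2).
    have hY : `|Y i j t| <= K + 1.
      rewrite -[Y i j t](subrK (X i j t)) addrC (le_trans (ler_normD _ _)) //.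
      by apply: lerD; [exact: HK|apply: (le_trans (HY i j t tab))].
    have h1 : `|u i t * Y i j t + y i t * (Y i j t - X i j t)| <= `|u i t| * (K + 1) + C * d.
      rewrite (le_trans (ler_normD _ _)) // !normrM; apply: lerD.
        exact: ler_wpM2l.
      by apply: ler_pM => //; [exact: HC|exact: HY].
    apply: (le_trans (ler_wpM2r _ h1)); first by rewrite mulr_ge0.
    have sq (x : R) : x * x = `|x| * `|x| by rewrite -!expr2 real_normK ?num_real.
    rewrite (sq (u i t)) (sq (u j t)).
    move: (`|u i t|) (`|u j t|) (normr_ge0 (u i t)) (normr_ge0 (u j t)) => p q p0 q0.
    have h2 : 0 <= (p - q) ^+ 2 * (K + 1) by rewrite mulr_ge0 ?sqr_ge0 //; lra.
    have h3 : 0 <= (q - C * d) ^+ 2 by exact: sqr_ge0.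
    by nra.
  have step1 : `|\sum_j (du j t * u j t + u j t * du j t)| <=
      \sum_j \sum_i ((u i t * u i t + u j t * u j t) * (K + 1) + (u j t * u j t + C ^+ 2 * d ^+ 2)).
    apply: (le_trans (ler_norm_sum _ _ _)); apply: ler_sum => j _.
    have -> : du j t * u j t + u j t * du j t = du j t * (2 * u j t) by ring.
    rewrite !normrM (ger0_norm (ler0n R 2)) /du.
    apply: (@le_trans _ _ (\sum_i (`|u i t * Y i j t + y i t * (Y i j t - X i j t)| * (2 * `|u j t|)))).
      rewrite -mulr_suml; apply: ler_wpM2r; first by rewrite mulr_ge0.
      exact: ler_norm_sum.
    by apply: ler_sum => i _; exact: term.
  apply: (le_trans step1).
  have inner j : \sum_i ((u i t * u i t + u j t * u j t) * (K + 1) + (u j t * u j t + C ^+ 2 * d ^+ 2)) =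
      (E t * (K + 1) + N * (C ^+ 2 * d ^+ 2)) + u j t * u j t * (N * (K + 1) + N).
    rewrite big_split /= -mulr_suml !big_split /= !sum_cst -/N -/(E t); ring.
  rewrite (eq_bigr _ (fun j _ => inner j)) big_split /= -mulr_suml sum_cst -/N -/(E t).
  have hE : 0 <= E t by apply: sumr_ge0 => j _; rewrite -expr2 sqr_ge0.
  by rewrite -subr_ge0 (_ : _ - _ = E t) //; rewrite /L /c; ring.
move=> j t tab.
have h := gronwall L0 c0 E0 HE HB ab0 tab.
have hu : `|u j t| ^+ 2 <= eta ^+ 2.
  rewrite real_normK ?num_real // expr2 (le_trans (uE j t)) // (le_trans h) //.
  apply: le_trans dD.
  have -> : d ^+ 2 * D = c / L * expR (L * (b - a)) by rewrite /D /c; field; rewrite gt_eqF.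
  apply: ler_wpM2l; first by rewrite divr_ge0 // ltW.
  rewrite ler_expR; apply: ler_wpM2l; first exact: ltW.
  by move: tab => /andP[? ?]; rewrite ler_norml; apply/andP; split; lra.
by rewrite -(@ler_pXn2r _ 2) ?nnegrE // ltW.
Qed.

End ContinuousDependence.

(** * Smooth dependence on a parameter *)

Section SmoothDependence.
Context {R : realType}.
Implicit Types (a b t x : R).

Definition obox (a b : R) (J : set R) : set (R * R) :=
  [set p | a < p.1 < b /\ J p.2].

Lemma open_obox a b (J : set R) : open J -> open (obox a b J).
Proof.
move=> oJ.
have -> : obox a b J = (fst @^-1` [set x : R | a < x] `&` fst @^-1` [set x : R | x < b]) `&` (snd @^-1` J).
  by apply/seteqP; split=> -[p1 p2] /=; [move=> [/andP[? ?] ?]|move=> [[? ?] ?]; split=> //; apply/andP].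
have cf : continuous (fst : R * R -> R) by move=> p; exact: cvg_fst.
have cs : continuous (snd : R * R -> R) by move=> p; exact: cvg_snd.
apply: openI; [apply: openI|].
- by apply: open_comp => [? _|]; [exact: cf|exact: open_gt].
- by apply: open_comp => [? _|]; [exact: cf|exact: open_lt].
- by apply: open_comp => [? _|]; [exact: cs|].
Qed.

Lemma continuous_slice (g : R * R -> R) t x :
  {for (t, x), continuous g} -> {for t, continuous (fun t => g (t, x))}.
Proof.
move=> cg; apply: (@continuous_comp _ _ _ (fun t => (t, x)) g) => //.
by apply: (@cvg_pair _ _ _ (nbhs t) (nbhs t) (nbhs x) _ _ _ id (fun=> x)); [exact: cvg_id|exact: cvg_cst].
Qed.

Lemma uniform_on_segment_family (P : finType) (g : P -> R * R -> R) a b x (d : R) :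
  (forall p t, a <= t <= b -> {for (t, x), continuous (g p)}) -> 0 < d ->
  exists2 r : R, 0 < r & forall p t h, a <= t <= b -> `|h| < r ->
    `|g p (t, x + h) - g p (t, x)| <= d.
Proof.
move=> cg d0.
have /choice [r Hr] (p : P) : exists r : R, 0 < r /\ forall t h,
    a <= t <= b -> `|h| < r -> `|g p (t, x + h) - g p (t, x)| <= d.
  by have [r r0 Hr] := uniform_on_segment (cg p) d0; exists r.
have /nbhs_ballP [r1 /= r10 Hr1] : \forall h \near (0 : R), forall p, `|h| < r p.
  apply: (@filter_forall R P (fun p h => `|h| < r p) (nbhs (0 : R)) _ _) => p.
  apply/nbhs_ballP; exists (r p); first exact: (Hr p).1.
  by move=> h; rewrite /ball /= sub0r normrN.
exists r1 => // p t h tab hr; apply: (Hr p).2 => //.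
by apply: Hr1; rewrite /ball /= sub0r normrN.
Qed.

(** Coefficients of the first variation: when [X'] is the derivative of [X] in a
    parameter x, a solution y and its derivative dy/dx together form a solution
    of this block-triangular system. *)
Definition variational (I : finType) (X X' : I -> I -> R * R -> R)
    (s s' : I + I) : R * R -> R :=
  match s, s' with
  | inl i, inl j => X i j
  | inl i, inr j => X' i j
  | inr i, inl j => fun=> 0
  | inr i, inr j => X i j
  end.

(** Induction on [m]. For a fixed step h, the solution y(x) and the difference
    quotient (y(x + h) - y(x)) / h together solve a linear system of the shape of
    [variational], in which the derivative of X is replaced by its difference
    quotient. Its coefficients converge uniformly in time as h tends to 0, so by
    continuous dependence dy/dx exists and is the second half of the solution of
    the variational system. That solution is C^m when X is C^(m+1), by induction,
    and so is dy/dt = y X; hence y is C^(m+1). *)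
Lemma ode_smooth_dependence m (I : finType) (X : I -> I -> R * R -> R)
    (y : I -> R * R -> R) (c : I -> R) a b (J : set R) (Om : set (R * R)) :
  a <= 0 <= b -> open J -> open Om ->
  (forall t x, a <= t <= b -> J x -> Om (t, x)) ->
  (forall i j, Ck m Om (X i j)) ->
  (forall j x, J x -> y j (0, x) = c j) ->
  (forall x, J x -> ode_solution (fun i j t => X i j (t, x)) a b (fun j t => y j (t, x))) ->
  forall j, Ck m (obox a b J) (y j).
Proof.
move=> ab0 oJ oOm OmJ.
have obx := @open_obox a b J oJ.
have Xc n (I' : finType) (X' : I' -> I' -> R * R -> R) i j t x : (forall i j, Ck n Om (X' i j)) ->
    a <= t <= b -> J x -> {for t, continuous (fun t => X' i j (t, x))}.
  move=> cX tab Jx; exact: continuous_slice (Ck_cont (cX i j) (OmJ _ _ tab Jx)).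
elim: m I X y c => [|m IH] I X y c cX y0 Hy.
  move=> j [t0 x0] [/= t0ab Jx0].
  have tab : a <= t0 <= b by lra.
  have dy := der_continuous (Hy x0 Jx0 j t0 tab).
  apply/cvgrPdist_lt => e e0; have e2 : 0 < e / 2 by lra.
  have cX0 i k t (tb : a <= t <= b) := Xc _ _ _ i k t x0 cX tb Jx0.
  have [d d0 CD] := ode_continuous_dependence ab0 cX0 (Hy x0 Jx0) e2.
  have [r r0 Hr] := @uniform_on_segment_family (I * I)%type (fun p => X p.1 p.2) a b x0 d
    (fun p t tb => Ck_cont (cX p.1 p.2) (OmJ _ _ tb Jx0)) d0.
  have nJ : \forall x \near x0, J x by exact: open_nbhs_nbhs.
  have nX : \forall x \near x0, `|x - x0| < r.
    by apply/nbhs_ballP; exists r => // x; rewrite /ball /= distrC.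
  have nc : \forall t \near t0, `|y j (t0, x0) - y j (t, x0)| < e / 2.
    by move/cvgrPdist_lt: dy; apply.
  have nt : \forall t \near t0, a < t < b.
    by have := near_in_itvoo (t0ab : t0 \in `]a, b[); apply: filterS => t; rewrite in_itv.
  exists ([set t | `|y j (t0, x0) - y j (t, x0)| < e / 2 /\ a < t < b],
          [set x | J x /\ `|x - x0| < r]).
    by split; apply: filterI.
  move=> [t x] [/= [h1 h2] [Jx h3]].
  have h4 : `|y j (t, x) - y j (t, x0)| <= e / 2.
    apply: (CD (fun i k s => X i k (s, x)) (fun k s => y k (s, x))) => //.
    - move=> i k s sab; have := Hr (i, k) s (x - x0) sab h3.
      by rewrite [x0 + _]addrC subrK.
    - exact: Hy.
    - by move=> k; rewrite !y0.
    - by lra.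
  move: h1 h4; rewrite ltr_norml ler_norml => /andP[? ?] /andP[? ?].
  by rewrite ltr_norml; apply/andP; split; lra.
have cX' i j := Ck_pred (cX i j).
have Cy j := IH I X y c cX' y0 Hy j.
pose X' i j (p : R * R) := 'D_(0, 1) (X i j) p.
have CX' i j : Ck m Om (X' i j) by exact: (cX i j).2.
pose V := variational X X'.
have CV s s' : Ck m Om (V s s').
  by case: s s' => i [] j //=; exact: Ck_cst.
pose c' (s : I + I) := match s with inl i => c i | inr i => 0 end.
have /choice [w0 Hw0] (x : R) : exists w : I + I -> R -> R, J x ->
    (forall s, w s 0 = c' s) /\ ode_solution (fun i j t => V i j (t, x)) a b w.
  have [Jx|] := pselect (J x); last by exists (fun _ _ => 0).
  have [||w Hw] := @ode_exists R _ (fun i j t => V i j (t, x)) c' a b.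
  - by case/andP: ab0; exact: le_trans.
  - by move=> i j t tab; exact: Xc CV tab Jx.
  by exists w.
pose w s (p : R * R) := w0 p.2 s p.1.
have Cw s : Ck m (obox a b J) (w s).
  apply: (IH _ V w c') => //; first by move=> j x Jx; exact: (Hw0 x Jx).1.
  by move=> x Jx; exact: (Hw0 x Jx).2.
have dx j t x : a <= t <= b -> J x -> is_derive x 1 (fun x => y j (t, x)) (w (inr j) (t, x)).
  move=> tab Jx.
  pose z (h : R) (s : I + I) (t : R) := match s with
    | inl i => y i (t, x) | inr i => h^-1 * (y i (t, x + h) - y i (t, x)) end.
  pose Q (h : R) (s s' : I + I) (t : R) := match s, s' with
    | inl i, inl j => X i j (t, x)
    | inl i, inr j => h^-1 * (X i j (t, x + h) - X i j (t, x))
    | inr i, inl j => 0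
    | inr i, inr j => X i j (t, x + h)
    end.
  have Hz h : h != 0 -> J (x + h) -> ode_solution (Q h) a b (z h).
    move=> h0 Jh [i|i] s sab.
      apply: (der_eq (Hy x Jx i s sab)).
      rewrite /ode_field big_sumType /= [X in _ + X]big1 ?addr0 // => k _; exact: mulr0.
    apply: (der_eq (derZ h^-1 (derB (Hy _ Jh i s sab) (Hy x Jx i s sab)))).
    rewrite /ode_field big_sumType /= -big_split -sumrB mulr_sumr; apply: eq_bigr => k _ /=; ring.
  have nJ : \forall h \near (0 : R), J (x + h).
    have : \forall x \near x, J x by exact: open_nbhs_nbhs.
    by rewrite (near_shift 0 x) /=; apply: filterS => h; rewrite /= subr0 addrC.
  have /nbhs_ballP [rJ /= rJ0 HrJ] := nJ.
  have HJ (h : R) : `|h| < rJ -> J (x + h) by move=> hr; apply: HrJ; rewrite /ball /= sub0r normrN.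
  have dX i k s (h : R) : a <= s <= b -> J h ->
      is_derive h 1 (fun h => X i k (s, h)) (X' i k (s, h)).
    move=> sab Jh; apply: (@derive_snd _ (X i k) (s, h)).
    apply: derivableP; apply: diff_derivable; exact: (cX i k).1 (OmJ _ _ sab Jh).
  have key eta : 0 < eta -> exists2 r : R, 0 < r & forall h, `|h| < r -> h != 0 ->
      `|h^-1 * (y j (t, x + h) - y j (t, x)) - w (inr j) (t, x)| <= eta.
    move=> eta0.
    have [d d0 CD] := ode_continuous_dependence ab0
      (fun i k s sb => Xc _ _ _ i k s x CV sb Jx) (Hw0 x Jx).2 eta0.
    have [r r0 Hr] := @uniform_on_segment_family ((I + I) * (I + I))%type
      (fun p => V p.1 p.2) a b x d
      (fun p t tb => Ck_cont (CV p.1 p.2) (OmJ _ _ tb Jx)) d0.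
    exists (Num.min r rJ); first by rewrite lt_min r0.
    move=> h; rewrite lt_min => /andP[hr hrJ] h0.
    apply: (CD (Q h) (z h) _ (Hz h h0 (HJ h hrJ)) _ (inr j) t tab).
      move=> [i|i] [k|k] s sab /=.
      - by rewrite subrr normr0 ltW.
      - have [|u uh ->] := @MVT_increment _ (fun x => X i k (s, x)) (fun x => X' i k (s, x)) x h.
          by move=> u uh; apply: dX => //; apply: HJ; exact: le_lt_trans hrJ.
        rewrite mulrC mulfK //.
        by apply: (Hr (inl i, inr k) s u sab); exact: le_lt_trans hr.
      - by rewrite subrr normr0 ltW.
      - exact: (Hr (inr i, inr k) s h sab hr).
    have w00 := (Hw0 x Jx).1.
    by move=> [i|i] /=; rewrite w00 /= !y0 ?subrr ?mulr0 //; exact: HJ.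
  have lim : h^-1 *: (((fun x => y j (t, x)) \o shift x) (h *: (1 : R)) - y j (t, x))
       @[h --> (0 : R)^'] --> w (inr j) (t, x).
    apply/cvgrPdist_le => e e0; have [r r0 Hr] := key e e0.
    exists r => //= h; rewrite /ball_ /= sub0r normrN => hr h0.
    rewrite distrC; have := Hr h hr h0.
    by rewrite /GRing.scale /= mulr1 (addrC h).
  by split; [apply/cvg_ex; exists (w (inr j) (t, x))|apply: cvg_lim].
move=> j.
pose ft (p : R * R) := \sum_i y i p * X i j p.
have bOm : obox a b J `<=` Om.
  by move=> [t x] [/= tab Jx]; apply: OmJ => //; lra.
have Cft : Ck m (obox a b J) ft.
  apply: (Ck_sum obx) => i; apply: (Ck_mul obx); first exact: Cy.
  by apply: Ck_sub bOm _; exact: cX'.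
have FP p : obox a b J p -> differentiable (y j) p /\
    forall v, 'D_v (y j) p = v.1 * ft p + v.2 * w (inr j) p.
  move=> bp; apply: frechet_partials.
  - have : \forall q \near p, obox a b J q by exact: open_nbhs_nbhs.
    apply: filterS => -[t x] [/= tab Jx]; apply: Hy => //; lra.
  - exact: Ck_cont Cft bp.
  - by case: p bp => t x [/= tab Jx]; apply: dx => //; lra.
split=> [p /FP[]//|v].
apply: (@Ck_ext _ _ _ _ _ (fun p => v.1 * ft p + v.2 * w (inr j) p)) => //.
  by move=> p /FP[_ ->].
apply: (Ck_add obx); apply: (Ck_mul obx) => //; exact: Ck_cst.
Qed.

Lemma ode_smooth_family m (I : finType) (X : I -> I -> R * R -> R)
    (c : I -> R) a b (J : set R) (Om : set (R * R)) :
  a <= 0 <= b -> open J -> open Om ->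
  (forall t x, a <= t <= b -> J x -> Om (t, x)) ->
  (forall i j, Ck m Om (X i j)) ->
  exists y : I -> R * R -> R,
  [/\ (forall j x, J x -> y j (0, x) = c j),
      (forall x, J x -> ode_solution (fun i j t => X i j (t, x)) a b (fun j t => y j (t, x)))
    & (forall j, Ck m (obox a b J) (y j))].
Proof.
move=> ab0 oJ oOm OmJ cX.
have /choice [w0 Hw0] (x : R) : exists w : I -> R -> R, J x ->
    (forall s, w s 0 = c s) /\ ode_solution (fun i j t => X i j (t, x)) a b w.
  have [Jx|] := pselect (J x); last by exists (fun _ _ => 0).
  have [||w Hw] := @ode_exists R _ (fun i j t => X i j (t, x)) c a b.
  - by case/andP: ab0; exact: le_trans.
  - move=> i j t tab; exact: continuous_slice (Ck_cont (cX i j) (OmJ _ _ tab Jx)).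
  by exists w.
pose w s (p : R * R) := w0 p.2 s p.1.
have w_init j x : J x -> w j (0, x) = c j by move=> Jx; exact: (Hw0 x Jx).1.
have w_sol x : J x -> ode_solution (fun i j t => X i j (t, x)) a b (fun j t => w j (t, x)).
  by move=> Jx; exact: (Hw0 x Jx).2.
exists w; split=> //; exact: (ode_smooth_dependence ab0 oJ oOm OmJ cX w_init w_sol).
Qed.

End SmoothDependence.

(** * The function atan s / s as a smooth function of s^2 *)

Section AtanQuotient.
Context {R : realType}.
Implicit Types (s t x : R).

(** The function is g(x) = int_0^1 du / (1 + x u^2), the value at time 1 of a
    linear system with parameter x; this makes it smooth across x = 0, where the
    formula atan(sqrt x) / sqrt x is of no use. The relation satisfied by its
    derivative is obtained by differentiating s g(s^2) = atan s. *)
Lemma atan_quotient_smooth m : exists (V : set R) (g g' : R -> R),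
  [/\ open V, (forall x, 0 <= x -> V x), Ck m.+1 V g,
      (forall s, s * g (s ^+ 2) = atan s) &
      forall x, 0 <= x -> is_derive x 1 g (g' x) /\
        2 * x * g' x + g x = (1 + x)^-1].
Proof.
(* for -2 <= t <= 2 and x > -1/8 the denominator 1 + x t^2 exceeds 1/2 *)
pose J : set R := [set x | - 8^-1 < x].
have oJ : open J by exact: open_gt.
pose den (p : R * R) : R := 1 + p.2 * (p.1 * p.1).
pose Om : set (R * R) := den @^-1` [set x : R | 0 < x].
have Cden n (U : set (R * R)) : open U -> Ck n U den.
  move=> oU; apply: (Ck_add oU); first exact: Ck_cst.
  by apply: (Ck_mul oU); [exact: Ck_snd|apply: (Ck_mul oU); exact: Ck_fst].
have oOm : open Om.
  apply: open_comp => [p _|]; last exact: open_gt.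
  exact: (Ck_cont (Cden 0%N setT openT)).
have hOm t x : -2 <= t <= 2 -> J x -> Om (t, x).
  move=> /andP[t1 t2]; rewrite /J /Om /den /= => hx.
  have h1 : t * t <= 4 by nra.
  have h2 : 0 <= t * t by nra.
  by nra.
(* the component [true] is constant and feeds the component [false] *)
pose X (i j : bool) (p : R * R) : R := if i && ~~ j then (den p)^-1 else 0.
have CX i j : Ck m.+1 Om (X i j).
  rewrite /X; case: (i && ~~ j); last exact: Ck_cst.
  by apply: Ck_inv => // [p|]; [rewrite /Om /=; move/lt0r_neq0|exact: Cden].
have ab0 : -2 <= (0 : R) <= 2 by lra.
have [y [y0 Hy Cy]] := ode_smooth_family (fun j : bool => j%:R) ab0 oJ oOm hOm CX.
have y1 t x : J x -> 0 <= t <= 2 -> y true (t, x) = 1.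
  move=> Jx /andP[t0 t2]; rewrite -[RHS]/(true%:R : R) -(y0 true x Jx); apply/esym.
  apply: (@der0_cst _ (fun t => y true (t, x))) => // s /andP[s0 st].
  have sab : -2 <= s <= 2 by lra.
  apply: (der_eq (Hy x Jx true s sab)).
  by rewrite /ode_field big_bool /X /= !mulr0 addr0.
have dy t x : J x -> 0 <= t <= 2 ->
    is_derive t 1 (fun t => y false (t, x)) (den (t, x))^-1.
  move=> Jx /andP[t0 t2]; have sab : -2 <= t <= 2 by lra.
  apply: (der_eq (Hy x Jx false t sab)).
  by rewrite /ode_field big_bool /X /= mulr0 addr0 y1 ?mul1r //; lra.
pose g x := y false (1, x).
have Cg : Ck m.+1 J g.
  apply: (@Ck_comp2 _ _ _ _ (obox (-2) 2 J) (y false) (fun=> 1) id) => //.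
  - by move=> x Jx; split=> //=; lra.
  - exact: Ck_cst.
  - exact: Ck_id.
have J0 x : 0 <= x -> J x by rewrite /J /=; lra.
have gatan s : s * g (s ^+ 2) = atan s.
  have Js : J (s ^+ 2) by apply: J0; exact: sqr_ge0.
  pose h t := s * y false (t, s ^+ 2) - atan (s * t).
  have dh t : 0 <= t <= 1 -> is_derive t 1 h 0.
    move=> /andP[t0 t1].
    have tab : 0 <= t <= 2 by lra.
    have dst : is_derive t 1 (fun t : R => s * t) s.
      by apply: (der_eq (derZ s (is_derive_id t 1))); rewrite mulr1.
    apply: (der_eq (derB (derZ s (dy _ _ Js tab)) (is_derive1_comp (is_derive1_atan (s * t)) dst))).
    by rewrite /den /= exprMn [s * _]mulrC -[t * t]expr2 subrr.
  have := der0_cst ler01 dh.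
  rewrite /h mulr1 mulr0 atan0 (y0 false) // mulr0 subrr.
  by move/esym/eqP; rewrite subr_eq0 => /eqP.
have g0 : g 0 = 1.
  have J00 : J 0 by exact: J0.
  have dh t : 0 <= t <= 1 -> is_derive t 1 (fun t => y false (t, 0) - t) 0.
    move=> /andP[t0 t1]; have tab : 0 <= t <= 2 by lra.
    apply: (der_eq (derB (dy t 0 J00 tab) (is_derive_id t 1))).
    by rewrite /den /= mul0r addr0 invr1 subrr.
  have := der0_cst ler01 dh.
  by rewrite (y0 false) // subr0 => /esym/eqP; rewrite subr_eq0 => /eqP.
pose g' x := 'D_1 g x.
have dg x : 0 <= x -> is_derive x 1 g (g' x).
  by move=> x0; apply: derivableP; apply: diff_derivable; exact: Cg.1 (J0 _ x0).
exists J, g, g'; split=> // x x0; split; first exact: dg.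
have [x00|xn0] := eqVneq x 0.
  by rewrite x00 mulr0 mul0r add0r g0 addr0 invr1.
pose s := Num.sqrt x.
have sE : s ^+ 2 = x by rewrite sqr_sqrtr.
have dsq : is_derive s 1 (fun s : R => s ^+ 2) (2 * s).
  by apply: (der_eq (derM (is_derive_id s 1) (is_derive_id s 1))); ring.
have dgs : is_derive (s ^+ 2) 1 g (g' x) by rewrite sE; exact: dg.
have d1 := derM (is_derive_id s 1) (@is_derive1_comp R g (fun s => s ^+ 2) s _ _ dgs dsq).
have d2 : is_derive s 1 (fun s => s * g (s ^+ 2)) (1 + s ^+ 2)^-1.
  have E : (fun s : R => s * g (s ^+ 2)) = atan :> (R -> R) by apply/funext => u; exact: gatan.
  by rewrite E; exact: is_derive1_atan.
have := @derive_val _ _ _ _ _ _ _ d1; have := @derive_val _ _ _ _ _ _ _ d2.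
move=> -> /=; rewrite sE => ->. 
have -> : s * (g' x * (2 * s)) = 2 * s ^+ 2 * g' x by ring.
by rewrite sE mul1r addrC.
Qed.

End AtanQuotient.

(** * Antisymmetric matrices and Rodrigues' formula *)

Section HatMatrices.
Context {R : realType}.
Implicit Types (X Y Z W : 'M[R]_3).

Lemma sum3E (V : nmodType) (F : 'I_3 -> V) : \sum_i F i = F 0 + F 1 + F 2%:R.
Proof.
rewrite !big_ord_recl big_ord0 addr0 addrA.
by congr (F _ + F _ + F _); apply: val_inj.
Qed.

Lemma ord3P (P : 'I_3 -> Prop) : P 0 -> P 1 -> P 2%:R -> forall i, P i.
Proof.
move=> P0 P1 P2 [[|[|[|//]]] lti].
- by rewrite (_ : Ordinal lti = 0) //; apply: val_inj.
- by rewrite (_ : Ordinal lti = 1) //; apply: val_inj.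
- by rewrite (_ : Ordinal lti = 2%:R) //; apply: val_inj.
Qed.

Definition hat (x y z : R) : 'M[R]_3 :=
  \matrix_(i, j) nth 0 (nth [::] [:: [:: 0; - z; y]; [:: z; 0; - x]; [:: - y; x; 0]] i) j.

Lemma so3_hat Y : so3 Y -> Y = hat (Y 2%:R 1) (Y 0 2%:R) (Y 1 0).
Proof.
move=> hY.
have h i j : Y j i = - Y i j by have := congr1 (fun M : 'M[R]_3 => M i j) hY; rewrite !mxE.
have h0 i : Y i i = 0 by have := h i i; lra.
apply/matrixP; elim/ord3P; elim/ord3P; rewrite !mxE /= ?h0 //; exact: h.
Qed.

Lemma hat_so3 x y z : so3 (hat x y z).
Proof.
by apply/matrixP; elim/ord3P; elim/ord3P; rewrite !mxE /= ?oppr0 ?opprK.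
Qed.

Lemma hatZ c x y z : c *: hat x y z = hat (c * x) (c * y) (c * z).
Proof.
by apply/matrixP; elim/ord3P; elim/ord3P; rewrite !mxE /= ?mulr0 ?mulrN.
Qed.

Lemma vec_hat x y z : vec (hat x y z) = \col_i nth 0 [:: x; y; z] i.
Proof. by apply/colP; elim/ord3P; rewrite !mxE. Qed.

Lemma anorm_hat x y z : anorm (hat x y z) = Num.sqrt (x ^+ 2 + y ^+ 2 + z ^+ 2).
Proof. by rewrite /anorm /enorm sum3E vec_hat !mxE. Qed.

Lemma anormZ c x y z : anorm (hat (c * x) (c * y) (c * z)) = `|c| * anorm (hat x y z).
Proof.
rewrite !anorm_hat !exprMn -!mulrDr sqrtrM ?sqr_ge0 //.
by rewrite sqrtr_sqr.
Qed.

Lemma hat_inj x y z x' y' z' : hat x y z = hat x' y' z' -> [/\ x = x', y = y' & z = z'].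
Proof.
move=> /matrixP h; split.
- by have := h 2%:R 1; rewrite !mxE.
- by have := h 0 2%:R; rewrite !mxE.
- by have := h 1 0; rewrite !mxE.
Qed.

Lemma hat_eq0 x y z : (hat x y z == 0) = (anorm (hat x y z) == 0).
Proof.
rewrite anorm_hat; apply/eqP/idP.
  have -> : 0 = hat 0 0 0 by apply/matrixP; elim/ord3P; elim/ord3P; rewrite !mxE /= ?oppr0.
  by move=> /hat_inj [-> -> ->]; rewrite expr0n /= !addr0 sqrtr0.
rewrite sqrtr_eq0 => h.
have hx := sqr_ge0 x; have hy := sqr_ge0 y; have hz := sqr_ge0 z.
have x0 : x = 0 by apply/eqP; rewrite -sqrf_eq0; apply/eqP; lra.
have y0 : y = 0 by apply/eqP; rewrite -sqrf_eq0; apply/eqP; lra.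
have z0 : z = 0 by apply/eqP; rewrite -sqrf_eq0; apply/eqP; lra.
by rewrite x0 y0 z0; apply/matrixP; elim/ord3P; elim/ord3P; rewrite !mxE /= ?oppr0.
Qed.

Lemma hat_mul x y z x' y' z' : hat x y z *m hat x' y' z' = \matrix_(i, j)
  nth 0 (nth [::] [:: [:: - (z * z' + y * y'); y * x'; z * x'];
                      [:: x * y'; - (z * z' + x * x'); z * y'];
                      [:: x * z'; y * z'; - (y * y' + x * x')]] i) j.
Proof.
apply/matrixP; elim/ord3P; elim/ord3P; rewrite !mxE sum3E !mxE /=; ring.
Qed.

Lemma hat_cube x y z : x ^+ 2 + y ^+ 2 + z ^+ 2 = 1 ->
  hat x y z *m hat x y z *m hat x y z = - hat x y z.
Proof.
move=> n1; rewrite -scaleN1r -n1 hat_mul.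
apply/matrixP; elim/ord3P; elim/ord3P; rewrite !mxE sum3E !mxE /=; ring.
Qed.

(** Rodrigues' formula: N^3 = -N reduces the exponential series to the series of
    sine and cosine. *)
Lemma expM_rodrigues (x y z th : R) : x ^+ 2 + y ^+ 2 + z ^+ 2 = 1 ->
  let N := hat x y z in
  expM (th *: N) = 1%:M + sin th *: N + (1 - cos th) *: (N *m N).
Proof.
move=> n1 N.
have N3 : N * N * N = - N by exact: hat_cube.
have N2 : N *m N = N * N by [].
have powN k : N ^+ k.*2.+1 = (-1) ^+ k *: N /\ N ^+ k.*2.+2 = (-1) ^+ k *: (N * N).
  elim: k => [|k [_ IH]]; first by rewrite expr1 expr2 !scale1r.
  have e1 : N ^+ k.+1.*2.+1 = (-1) ^+ k.+1 *: N.
    by rewrite doubleS exprSr IH -scalerAl N3 scalerN exprS mulN1r scaleNr.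
  by split=> //; rewrite exprSr e1 -scalerAl.
pose t (k : nat) : 'M[R]_3 := (k`!%:R : R)^-1 *: (th *: N) ^+ k.
pose C0 : 'M[R]_3 := 1 + N * N.
have tE k : t k = (k == 0%N)%:R *: C0 + sin_coeff th k *: N - cos_coeff th k *: (N * N).
  rewrite /t exprZn scalerA /sin_coeff /cos_coeff /=.
  case: k => [|k].
    by rewrite /= !expr0 fact0 expr0z invr1 !mulr1 scale0r addr0 !scale1r /C0 addrK.
  rewrite scale0r add0r -[k]odd_double_half; case: (odd k); rewrite ?add1n ?add0n.
    rewrite (powN k./2).2 scalerA /= !odd_double /= !mul0r scale0r sub0r -scaleNr doubleK.
    congr (_ *: _); rewrite mul1r /exprz /= [(-1) ^+ _.+1]exprS.
    by move: (th ^+ _) (_`!%:R) ((-1) ^+ _) => p q s; ring.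
  rewrite (powN k./2).1 scalerA /= !odd_double /= !mul0r scale0r subr0 doubleK.
  congr (_ *: _); rewrite mul1r /exprz /=.
  by move: (th ^+ _) (_`!%:R) ((-1) ^+ _) => p q s; ring.
have sE n : series t n = (n != 0%N)%:R *: C0 + series (sin_coeff th) n *: N - series (cos_coeff th) n *: (N * N).
  rewrite /series /= (eq_bigr _ (fun k _ => tE k)) sumrB big_split /= -!scaler_suml.
  congr (_ *: _ + _ - _); case: n => [|n]; first by rewrite big_geq.
  by rewrite big_nat_recl // big1 ?addr0.
rewrite /expM; apply: cvg_lim => //.
have -> : 1%:M + sin th *: N + (1 - cos th) *: (N *m N) = C0 + sin th *: N - cos th *: (N * N).
  by rewrite N2 scalerBl scale1r /C0 !addrA; congr (_ - _); rewrite addrAC.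
rewrite (_ : series _ = fun n => (n != 0%N)%:R *: C0 + series (sin_coeff th) n *: N - series (cos_coeff th) n *: (N * N)); last first.
  by apply/funext => n; exact: sE.
apply: cvgB.
  apply: cvgD.
    apply: cvg_near_cst; exists 1%N => // n /= n1'.
    by rewrite -lt0n n1' scale1r.
  apply: cvgZr_tmp; rewrite unlock; exact: is_cvg_series_sin_coeff.
apply: cvgZr_tmp; rewrite unlock; exact: is_cvg_series_cos_coeff.
Qed.

End HatMatrices.

(** * The exponential on balls of so(3) *)

Section ExponentialMap.
Context {R : realType}.
Implicit Types (X Y Z W : 'M[R]_3).

Lemma anorm_ge0 Y : 0 <= anorm Y.
Proof. exact: sqrtr_ge0. Qed.

Lemma so3_polar Y : so3 Y -> Y != 0 -> 0 < anorm Y /\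
  exists x y z : R, x ^+ 2 + y ^+ 2 + z ^+ 2 = 1 /\ Y = anorm Y *: hat x y z.
Proof.
move=> /so3_hat; set x := Y 2%:R 1; set y := Y 0 2%:R; set z := Y 1 0 => ->.
rewrite hat_eq0 => n0.
have np : 0 < anorm (hat x y z) by rewrite lt_def n0 anorm_ge0.
split=> //; set r := anorm _ in n0 np *.
exists (r^-1 * x), (r^-1 * y), (r^-1 * z); split; last first.
  by rewrite hatZ !mulrA divff // !mul1r.
have r2 : r ^+ 2 = x ^+ 2 + y ^+ 2 + z ^+ 2.
  by rewrite /r anorm_hat sqr_sqrtr // !addr_ge0 ?sqr_ge0.
by rewrite !exprMn -!mulrDr -r2 -exprMn mulVf // expr1n.
Qed.

Lemma anorm_unit x y z : x ^+ 2 + y ^+ 2 + z ^+ 2 = 1 -> anorm (hat x y z) = 1 :> R.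
Proof. by rewrite anorm_hat => ->; rewrite sqrtr1. Qed.

Lemma expM0 : expM (0 : 'M[R]_3) = 1%:M.
Proof.
have h : (1 : R) ^+ 2 + 0 ^+ 2 + 0 ^+ 2 = 1 by rewrite expr1n expr0n /= !addr0.
have := @expM_rodrigues R 1 0 0 0 h.
by rewrite /= scale0r sin0 cos0 subrr !scale0r !addr0.
Qed.

(** In the half angle the exponential is the rotation matrix of the unit
    quaternion with real part [c] and imaginary part [s] times the axis. *)
Lemma expM_half (x y z th : R) : x ^+ 2 + y ^+ 2 + z ^+ 2 = 1 ->
  let c := cos (th / 2) in let s := sin (th / 2) in
  expM (th *: hat x y z) = 1%:M + (2 * s * c) *: hat x y z
    + (2 * s ^+ 2) *: (hat x y z *m hat x y z).
Proof.
move=> n1 c s; rewrite expM_rodrigues //.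
have th2 : th = (th / 2) *+ 2 by rewrite mulr2n; lra.
have cs : c ^+ 2 + s ^+ 2 = 1 by exact: cos2Dsin2.
congr (_ + _ *: _ + _ *: _).
  by rewrite {1}th2 sin_mulr2n -/c -/s mulr2n; ring.
by rewrite {1}th2 cos_mulr2n -/c mulr2n; lra.
Qed.

Lemma half_angle (th : R) : 0 < th -> th < 2 * pi -> 0 < sin (th / 2).
Proof. by move=> h1 h2; apply: sin_gt0_pi; apply/andP; split; lra. Qed.

(** Two unit quaternions with the same rotation matrix agree up to sign. The
    symmetric parts give [s = s'] and equality of the products of two coordinates
    of the axes, so that the scalar product [e] of the axes is the sign; the
    antisymmetric parts compare [c] and [c']. *)
Lemma expM_eq_polar (x y z x' y' z' s c s' c' : R) :
  x ^+ 2 + y ^+ 2 + z ^+ 2 = 1 -> x' ^+ 2 + y' ^+ 2 + z' ^+ 2 = 1 ->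
  c ^+ 2 + s ^+ 2 = 1 -> c' ^+ 2 + s' ^+ 2 = 1 -> 0 < s -> 0 < s' ->
  1%:M + (2 * s * c) *: hat x y z + (2 * s ^+ 2) *: (hat x y z *m hat x y z) =
  1%:M + (2 * s' * c') *: hat x' y' z' + (2 * s' ^+ 2) *: (hat x' y' z' *m hat x' y' z') ->
  exists e : R, [/\ e ^+ 2 = 1, [/\ x' = e * x, y' = e * y & z' = e * z] & c = e * c'].
Proof.
move=> n1 n1' cs cs' s0 s0' /matrixP E.
have E00 := E 0 0; have E11 := E 1 1; have E22 := E 2%:R 2%:R.
have E01 := E 0 1; have E10 := E 1 0; have E02 := E 0 2%:R; have E20 := E 2%:R 0.
have E12 := E 1 2%:R; have E21 := E 2%:R 1.
move: E00 E11 E22 E01 E10 E02 E20 E12 E21; rewrite !hat_mul !mxE /= => E00 E11 E22 E01 E10 E02 E20 E12 E21.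
have ss : s ^+ 2 = s' ^+ 2.
  have : 2 * (2 * s ^+ 2) * (x ^+ 2 + y ^+ 2 + z ^+ 2) = 2 * (2 * s' ^+ 2) * (x' ^+ 2 + y' ^+ 2 + z' ^+ 2) by lra.
  by rewrite n1 n1' => ?; lra.
have es : s = s' by apply/eqP; rewrite -(eqrXn2 (n := 2)) // ?ss //; exact: ltW.
have s2 : s ^+ 2 != 0 by rewrite expf_neq0 // gt_eqF.
subst s'.
have cancel2 (p q : R) : s ^+ 2 * p = s ^+ 2 * q -> p = q by exact: mulfI.
have cancel1 (p q : R) : s * p = s * q -> p = q by apply: mulfI; rewrite gt_eqF.
have hx : x * x = x' * x' by apply: cancel2; lra.
have hy : y * y = y' * y' by apply: cancel2; lra.
have hz : z * z = z' * z' by apply: cancel2; lra.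
have hxy : x * y = x' * y' by apply: cancel2; lra.
have hxz : x * z = x' * z' by apply: cancel2; lra.
have hyz : y * z = y' * z' by apply: cancel2; lra.
have cx : c * x = c' * x' by apply: cancel1; lra.
have cy : c * y = c' * y' by apply: cancel1; lra.
have cz : c * z = c' * z' by apply: cancel1; lra.
pose e := x * x' + y * y' + z * z'.
have ex : x' = e * x.
  have -> : e * x = x' * (x * x) + y' * (x * y) + z' * (x * z) by rewrite /e; ring.
  rewrite hx hxy hxz; transitivity (x' * (x' ^+ 2 + y' ^+ 2 + z' ^+ 2)); last by ring.
  by rewrite n1' mulr1.
have ey : y' = e * y.
  have -> : e * y = x' * (x * y) + y' * (y * y) + z' * (y * z) by rewrite /e; ring.
  rewrite hy hxy hyz; transitivity (y' * (x' ^+ 2 + y' ^+ 2 + z' ^+ 2)); last by ring.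
  by rewrite n1' mulr1.
have ez : z' = e * z.
  have -> : e * z = x' * (x * z) + y' * (y * z) + z' * (z * z) by rewrite /e; ring.
  rewrite hz hxz hyz; transitivity (z' * (x' ^+ 2 + y' ^+ 2 + z' ^+ 2)); last by ring.
  by rewrite n1' mulr1.
exists e; split=> //.
  have : x' ^+ 2 + y' ^+ 2 + z' ^+ 2 = e ^+ 2 * (x ^+ 2 + y ^+ 2 + z ^+ 2) by rewrite ex ey ez; ring.
  by rewrite n1 n1' mulr1.
transitivity (c * (x ^+ 2 + y ^+ 2 + z ^+ 2)); first by rewrite n1 mulr1.
have -> : c * (x ^+ 2 + y ^+ 2 + z ^+ 2) = (c * x) * x + (c * y) * y + (c * z) * z by ring.
by rewrite cx cy cz /e; ring.
Qed.

Lemma expM_eq1 Y : so3 Y -> anorm Y < 2 * pi -> expM Y = 1%:M -> Y = 0.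
Proof.
move=> hY h2; apply: contra_eq => Y0.
have [np [x [y [z [n1 E]]]]] := so3_polar hY Y0.
rewrite E expM_half //; apply/eqP => /matrixP H.
have s0 := half_angle np h2.
have H0 := H 0 0; have H1 := H 1 1; have H2 := H 2%:R 2%:R.
move: H0 H1 H2; rewrite !hat_mul !mxE /=.
move: s0; move: (sin _) (cos _) => s c s0 H0 H1 H2.
have : 2 * (2 * s ^+ 2) * (x ^+ 2 + y ^+ 2 + z ^+ 2) = 0 by lra.
by rewrite n1 => h; have : 0 < s ^+ 2 by [rewrite exprn_gt0]; lra.
Qed.

(** In the open ball of radius 2 pi, a rotation different from the identity has
    two logarithms, theta n and (theta - 2 pi) n, and the identity only 0. *)
Lemma mod2pi_expM Z W : so3 Z -> so3 W -> anorm Z < 2 * pi -> anorm W < 2 * pi ->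
  expM W = expM Z -> mod2pi Z W.
Proof.
move=> hZ hW nZ nW E.
have [Z0|Z0] := eqVneq Z 0.
  exists 0; rewrite Z0 scaler0 addr0; apply: expM_eq1 => //.
  by rewrite E Z0 expM0.
have [W0|W0] := eqVneq W 0.
  by move: Z0; rewrite (expM_eq1 hZ nZ) ?eqxx // -E W0 expM0.
have [pZ [x [y [z [n1 EZ]]]]] := so3_polar hZ Z0.
have [pW [x' [y' [z' [n1' EW]]]]] := so3_polar hW W0.
move: E; rewrite EZ EW !expM_half //.
set th := anorm Z in nZ pZ EZ *; set th' := anorm W in nW pW EW * => E.
have := expM_eq_polar n1' n1 (cos2Dsin2 _) (cos2Dsin2 _) (half_angle pW nW) (half_angle pZ nZ) E.
move=> [e [e2 [ex ey ez] ec]].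
have thn : anorm (th *: hat x y z) = th.
  by rewrite hatZ anormZ anorm_unit // mulr1 gtr0_norm.
have inpi (u : R) : 0 < u -> u < 2 * pi -> u / 2 \in `[0, pi].
  by move=> h1 h2; rewrite in_itv /=; apply/andP; split; lra.
have : (e - 1) * (e + 1) == 0 by apply/eqP; rewrite -subr_sqr expr1n e2 subrr.
rewrite mulf_eq0 => /orP[/eqP e1|/eqP e1].
  have {}e1 : e = 1 by lra.
  move: ec ex ey ez; rewrite e1 !mul1r => ec -> -> ->.
  have h := cos_inj (inpi _ pW nW) (inpi _ pZ nZ) ec.
  exists 0; rewrite mulr0 !mul0r scale0r addr0; congr (_ *: _); lra.
(* opposite axes: W is the other logarithm, so k = -1 *)
have {}e1 : e = -1 by lra.
move: ec ex ey ez; rewrite e1 !mulN1r => ec ex ey ez.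
have h : th' / 2 = (2 * pi - th) / 2.
  apply: cos_inj; [exact: inpi|by apply: inpi; lra|].
  rewrite ec (_ : (2 * pi - th) / 2 = - (th / 2) + pi); last by field.
  by rewrite cosDpi cosN.
have hth : th' = 2 * pi - th by lra.
exists (-1); rewrite thn scalerA -scalerDl ex ey ez !hatZ.
have -> : th + 2 * (-1)%:~R * pi / th * th = - th'.
  by rewrite mulfVK ?gt_eqF // hth mulrN1z mulrN1 mulNr opprB addrC.
by rewrite !mulrNN.
Qed.

(** The map q leaves the axis unchanged and changes the angle by 0 or -2 pi. *)
Lemma qmap_spec X0 Y : so3 Y -> anorm Y <= pi ->
  [/\ so3 (qmap X0 Y), anorm (qmap X0 Y) < 2 * pi & expM (qmap X0 Y) = expM Y].
Proof.
move=> hY nY; have p0 := pi_gt0 R.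
rewrite /qmap; have [Y0|Y0] /= := eqVneq Y 0.
  by rewrite Y0; split=> //; [rewrite -Y0|rewrite -Y0; lra].
case: ifP => _; first by split=> //; lra.
have [np [x [y [z [n1 E]]]]] := so3_polar hY Y0.
set th := anorm Y in nY np E *.
have E' : (1 - 2 * pi / th) *: Y = (th - 2 * pi) *: hat x y z.
  rewrite E scalerA; congr (_ *: _); rewrite mulrBl mul1r mulfVK // gt_eqF //.
rewrite E'; split.
- by rewrite hatZ; exact: hat_so3.
- by rewrite hatZ anormZ anorm_unit // mulr1 ler0_norm; lra.
rewrite E !expM_rodrigues //; congr (_ + _ *: _ + _ *: _).
  by rewrite -(sinD2pi (th - 2 * pi)); congr sin; rewrite mulr2n; ring.
by rewrite -(cosD2pi (th - 2 * pi)); congr (1 - cos _); rewrite mulr2n; ring.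
Qed.

End ExponentialMap.

(** * Unit quaternions and their logarithm *)

Section Quaternions.
Context {R : realType}.
Implicit Types (q : 'I_4 -> R).

Lemma sum4E (V : nmodType) (F : 'I_4 -> V) : \sum_i F i = F 0 + F 1 + F 2%:R + F 3%:R.
Proof.
rewrite !big_ord_recl big_ord0 addr0 !addrA.
by congr (F _ + F _ + F _ + F _); apply: val_inj.
Qed.

Lemma ord4P (P : 'I_4 -> Prop) : P 0 -> P 1 -> P 2%:R -> P 3%:R -> forall i, P i.
Proof.
move=> P0 P1 P2 P3 [[|[|[|[|//]]]] lti].
- by rewrite (_ : Ordinal lti = 0) //; apply: val_inj.
- by rewrite (_ : Ordinal lti = 1) //; apply: val_inj.
- by rewrite (_ : Ordinal lti = 2%:R) //; apply: val_inj.
- by rewrite (_ : Ordinal lti = 3%:R) //; apply: val_inj.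
Qed.

Definition qnorm2 q : R := q 0 ^+ 2 + q 1 ^+ 2 + q 2%:R ^+ 2 + q 3%:R ^+ 2.

(** Matrix of the map w |-> Q w Q^* on imaginary quaternions. This form, homogeneous
    in Q, makes its derivative along Q' = Q x / 2 a polynomial identity. *)
Definition rotq q : 'M[R]_3 :=
  let a := q 0 in let b := q 1 in let c := q 2%:R in let d := q 3%:R in
  \matrix_(i, j) nth 0 (nth [::]
   [:: [:: a * a + b * b - c * c - d * d; 2 * (b * c - a * d); 2 * (b * d + a * c)];
       [:: 2 * (b * c + a * d); a * a - b * b + c * c - d * d; 2 * (c * d - a * b)];
       [:: 2 * (b * d - a * c); 2 * (c * d + a * b); a * a - b * b - c * c + d * d]] i) j.

(** Right multiplication of quaternions by (0, x, y, z) / 2. *)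
Definition quat_field (x y z : R) (i j : 'I_4) : R :=
  2^-1 * nth 0 (nth [::] [:: [:: 0; x; y; z]; [:: - x; 0; - z; y];
                      [:: - y; z; 0; - x]; [:: - z; - y; x; 0]] i) j.

Lemma rotqN q : rotq (fun i => - q i) = rotq q.
Proof. by apply/matrixP; elim/ord3P; elim/ord3P; rewrite !mxE /= !mulrNN. Qed.

Lemma rotq_orth q : qnorm2 q = 1 -> (rotq q)^T *m rotq q = 1%:M.
Proof.
move=> n1; have -> : (rotq q)^T *m rotq q = (qnorm2 q ^+ 2)%:M.
  by apply/matrixP; elim/ord3P; elim/ord3P; rewrite !mxE sum3E !mxE /= /qnorm2; ring.
by rewrite n1 expr1n.
Qed.

Lemma rotqE q : qnorm2 q = 1 -> let Q := hat (q 1) (q 2%:R) (q 3%:R) in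
  rotq q = 1%:M + (2 * q 0) *: Q + 2 *: (Q *m Q).
Proof.
move=> n1 Q; rewrite /Q hat_mul; move: n1; rewrite /qnorm2 => n1.
by apply/matrixP; elim/ord3P; elim/ord3P; rewrite !mxE /=; lra.
Qed.

Section Logarithm.
Variables (g g' : R -> R).
Hypothesis gatan : forall s, s * g (s ^+ 2) = atan s.
Hypothesis gode : forall x, 0 <= x -> 2 * x * g' x + g x = (1 + x)^-1.

(** Stereographic projection from -1: it maps the quaternion with real part
    cos(theta / 2) and imaginary part sin(theta / 2) n to tan(theta / 4) n. *)
Definition stereo q (i : 'I_4) : R := q i / (1 + q 0).
Definition stereo2 q : R := stereo q 1 ^+ 2 + stereo q 2%:R ^+ 2 + stereo q 3%:R ^+ 2.
(** As the projection is tan(theta / 4) n and [g (s ^+ 2)] is atan s / s, these are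
    the coordinates of theta n. *)
Definition quat_log_coord q (i : 'I_4) : R := 4 * g (stereo2 q) * stereo q i.
Definition quat_log q : 'M[R]_3 :=
  hat (quat_log_coord q 1) (quat_log_coord q 2%:R) (quat_log_coord q 3%:R).

Lemma stereo2_ge0 q : 0 <= stereo2 q.
Proof. by rewrite /stereo2 !addr_ge0 ?sqr_ge0. Qed.

Lemma stereo2E q : qnorm2 q = 1 -> -1 < q 0 -> stereo2 q = (1 - q 0) / (1 + q 0).
Proof.
rewrite /qnorm2 => n1 h; have h0 : 1 + q 0 != 0 by rewrite gt_eqF //; lra.
rewrite /stereo2 /stereo !expr_div_n -!mulrDl.
have -> : q 1 ^+ 2 + q 2%:R ^+ 2 + q 3%:R ^+ 2 = (1 - q 0) * (1 + q 0) by lra.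
by field.
Qed.

Lemma anorm_quat_log q : anorm (quat_log q) = 4 * atan (Num.sqrt (stereo2 q)).
Proof.
set y := stereo2 q; pose s := Num.sqrt y.
have s0 : 0 <= s by exact: sqrtr_ge0.
have s2 : s ^+ 2 = y by rewrite sqr_sqrtr // stereo2_ge0.
rewrite /quat_log /quat_log_coord anormZ anorm_hat -/y.
have -> : stereo q 1 ^+ 2 + stereo q 2%:R ^+ 2 + stereo q 3%:R ^+ 2 = y by [].
rewrite -/s -(gatan s) s2 normrM ger0_norm // -mulrA; congr (_ * _).
rewrite -[s in LHS]ger0_norm // -normrM mulrC -s2 gatan ger0_norm ?atan0 //.
by rewrite -atan0; apply: le_atan.
Qed.

Lemma quat_log_lt2pi q : anorm (quat_log q) < 2 * pi.
Proof. by rewrite anorm_quat_log; have := atan_ltpi2 (Num.sqrt (stereo2 q)); lra. Qed.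

Lemma quat_log_lepi q : qnorm2 q = 1 -> 0 <= q 0 -> anorm (quat_log q) <= pi.
Proof.
move=> n1 h; rewrite anorm_quat_log.
have : atan (Num.sqrt (stereo2 q)) <= atan 1.
  apply: le_atan; rewrite -[1]sqrtr1 ler_sqrt // stereo2E //; last lra.
  by rewrite ler_pdivrMr; lra.
by rewrite atan1; lra.
Qed.

Lemma double_atan (s : R) : cos (2 * atan s) = (1 - s ^+ 2) / (1 + s ^+ 2) /\
  sin (2 * atan s) = 2 * s / (1 + s ^+ 2).
Proof.
have p1 : 0 < 1 + s ^+ 2 by have := sqr_ge0 s; lra.
have c2 : cos (atan s) ^+ 2 = (1 + s ^+ 2)^-1.
  by rewrite cos_atan exprVn sqr_sqrtr // ltW.
have c0 : cos (atan s) != 0.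
  by apply/negP => /eqP c0; move: c2; rewrite c0 expr0n /= => /esym/eqP; rewrite invr_eq0 gt_eqF.
have st : sin (atan s) = s * cos (atan s).
  by rewrite -{2}(atanK s) /tan divfK.
have d : 2 * atan s = atan s *+ 2 by rewrite mulr_natl.
rewrite d cos_mulr2n sin_mulr2n st !mulr2n c2; split; first by field; rewrite gt_eqF.
have -> : cos (atan s) * (s * cos (atan s)) = s * cos (atan s) ^+ 2 by ring.
by rewrite c2; field; rewrite gt_eqF.
Qed.

Lemma expM_quat_log q : qnorm2 q = 1 -> -1 < q 0 -> expM (quat_log q) = rotq q.
Proof.
move=> n1 h; have h0 : 1 + q 0 != 0 by rewrite gt_eqF //; lra.
have yE := stereo2E n1 h; have y0 := stereo2_ge0 q.
pose s := Num.sqrt (stereo2 q).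
have s2 : s ^+ 2 = stereo2 q by rewrite sqr_sqrtr.
have qv i : q i = (1 + q 0) * stereo q i by rewrite /stereo mulrC divfK.
have [s0|s0] := eqVneq s 0.
  have yy0 : stereo2 q = 0 by rewrite -s2 s0 expr0n.
  have qq : q 0 = 1.
    by move/eqP: yy0; rewrite yE mulf_eq0 invr_eq0 (negbTE h0) orbF => /eqP; lra.
  have : quat_log q == 0 by rewrite hat_eq0 anorm_quat_log -/s s0 atan0 mulr0.
  move=> /eqP ->; rewrite expM0 rotqE //.
  have : hat (q 1) (q 2%:R) (q 3%:R) == 0.
    rewrite hat_eq0 anorm_hat; move: n1; rewrite /qnorm2 qq expr1n => n1.
    have -> : q 1 ^+ 2 + q 2%:R ^+ 2 + q 3%:R ^+ 2 = 0 by lra.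
    by rewrite sqrtr0.
  by move=> /eqP ->; rewrite mul0mx !scaler0 !addr0.
pose v i := stereo q i / s.
have vn : v 1 ^+ 2 + v 2%:R ^+ 2 + v 3%:R ^+ 2 = 1.
  have -> : v 1 ^+ 2 + v 2%:R ^+ 2 + v 3%:R ^+ 2 = stereo2 q / s ^+ 2 by rewrite /v /stereo2; field.
  by rewrite -s2 divff // expf_neq0.
have lE i : quat_log_coord q i = (4 * atan s) * v i.
  by rewrite /quat_log_coord /v -(gatan s) s2; field.
rewrite /quat_log !lE -hatZ expM_half // rotqE //.
have -> : 4 * atan s / 2 = 2 * atan s by field.
have [-> ->] := double_atan s.
have y1 : 1 + s ^+ 2 = 2 / (1 + q 0) by rewrite s2 yE; field.
have y2 : 1 - s ^+ 2 = 2 * q 0 / (1 + q 0) by rewrite s2 yE; field.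
have -> : hat (q 1) (q 2%:R) (q 3%:R) = ((1 + q 0) * s) *: hat (v 1) (v 2%:R) (v 3%:R).
  by rewrite hatZ; congr hat; rewrite qv /v; field.
rewrite -scalemxAl -scalemxAr !scalerA.
congr (_ + _ *: _ + _ *: _).
  by rewrite y1 y2; field.
by rewrite y1; field.
Qed.

(** Velocity of the stereographic projection along Q' = Q x / 2. *)
Definition stereo_field q (x : 'I_4 -> R) (i : 'I_4) : R :=
  let v := stereo q in
  4^-1 * ((1 - stereo2 q) * x i
    + 2 * nth 0 [:: 0; v 2%:R * x 3%:R - v 3%:R * x 2%:R;
                       v 3%:R * x 1 - v 1 * x 3%:R;
                       v 1 * x 2%:R - v 2%:R * x 1] i
    + 2 * (v 1 * x 1 + v 2%:R * x 2%:R + v 3%:R * x 3%:R) * v i).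

(** With s = tan(theta / 4), half of the norm theta is 2 atan s, whose sine and
    cosine are rational in s. *)
Lemma Zcoef_quat_log q : stereo2 q != 0 ->
  g (stereo2 q) != 0 /\
  Zcoef (anorm (quat_log q)) =
    (1 - g (stereo2 q) * (1 - stereo2 q)) / (16 * g (stereo2 q) ^+ 2 * stereo2 q).
Proof.
move=> y0; have yge := stereo2_ge0 q.
rewrite anorm_quat_log; set s := Num.sqrt _.
have s2 : s ^+ 2 = stereo2 q by rewrite sqr_sqrtr.
have sp : 0 < s by rewrite sqrtr_gt0 lt_def y0.
have ap : 0 < atan s by rewrite -atan0; apply: lt_atan.
have gE : g (stereo2 q) = atan s / s by rewrite -(gatan s) s2 mulrAC divff ?mul1r // gt_eqF.
have s1 : s != 0 by rewrite gt_eqF.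
have a1 : atan s != 0 by rewrite gt_eqF.
split; first by rewrite gE mulf_neq0 // invr_neq0.
rewrite /Zcoef mulf_eq0 (negbTE a1) orbF pnatr_eq0 /= /Zcoef_ne0.
have -> : 4 * atan s / 2 = 2 * atan s by field.
have [-> ->] := double_atan s.
have p1 : 1 + s ^+ 2 != 0 by rewrite gt_eqF //; have := sqr_ge0 s; lra.
rewrite gE -s2; field.
by rewrite a1 s1 p1.
Qed.

(** The right-hand side is the derivative of 4 g(|v|^2) v for v moving with
    velocity dv. When v is not 0, the differential equation of g eliminates g',
    and both sides become the same rational function of v, x and g. When v = 0,
    the factor Z^2 vanishes and only the coefficient 1 of the velocity remains. *)
Lemma Zfield_quat_log q (x : 'I_4 -> R) (i : 'I_3) :
  let v := stereo q in let dv := stereo_field q x in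
  let y := stereo2 q in
  let dy := 2 * (v 1 * dv 1 + v 2%:R * dv 2%:R + v 3%:R * dv 3%:R) in
  Zfield (quat_log q) (hat (x 1) (x 2%:R) (x 3%:R)) i 0 =
    4 * (g' y * dy * v (lift ord0 i) + g y * dv (lift ord0 i)).
Proof.
move=> v dv y dy.
have l0 : lift ord0 (0 : 'I_3) = 1 :> 'I_4 by apply: val_inj.
have l1 : lift ord0 (1 : 'I_3) = 2%:R :> 'I_4 by apply: val_inj.
have l2 : lift ord0 (2%:R : 'I_3) = 3%:R :> 'I_4 by apply: val_inj.
have yv : y = v 1 ^+ 2 + v 2%:R ^+ 2 + v 3%:R ^+ 2 by [].
have yge : 0 <= y by exact: stereo2_ge0.
have ode := gode yge.
rewrite /Zfield /quat_log hat_mul vec_hat -/(quat_log q).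
set C := Zcoef _.
have [y0|y0] := eqVneq y 0.
  have v1 : v 1 = 0 by apply/eqP; rewrite -sqrf_eq0; apply/eqP; have := sqr_ge0 (v 1); have := sqr_ge0 (v 2%:R); have := sqr_ge0 (v 3%:R); lra.
  have v2 : v 2%:R = 0 by apply/eqP; rewrite -sqrf_eq0; apply/eqP; have := sqr_ge0 (v 1); have := sqr_ge0 (v 2%:R); have := sqr_ge0 (v 3%:R); lra.
  have v3 : v 3%:R = 0 by apply/eqP; rewrite -sqrf_eq0; apply/eqP; have := sqr_ge0 (v 1); have := sqr_ge0 (v 2%:R); have := sqr_ge0 (v 3%:R); lra.
  have g1 : g y = 1 by move: ode; rewrite y0 mulr0 mul0r add0r addr0 invr1.
  by elim/ord3P: i; rewrite ?l0 ?l1 ?l2 !mxE sum3E !mxE /= /quat_log_coord /dv /stereo_field;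
    rewrite -/y -/v ?g1 ?v1 ?v2 ?v3 ?y0 /=; field.
have [g0 CE] := Zcoef_quat_log y0.
have gE : g' y = ((1 + y)^-1 - g y) / (2 * y) by rewrite -ode; field.
have y1 : 1 + y != 0 by rewrite gt_eqF //; lra.
have sq (a b : R) : 4 * g y * a * (4 * g y * a) + 4 * g y * b * (4 * g y * b) =
    16 * g y ^+ 2 * (a ^+ 2 + b ^+ 2) by ring.
have sq1 : v 3%:R ^+ 2 + v 2%:R ^+ 2 = y - v 1 ^+ 2 by lra.
have sq2 : v 3%:R ^+ 2 + v 1 ^+ 2 = y - v 2%:R ^+ 2 by lra.
have sq3 : v 2%:R ^+ 2 + v 1 ^+ 2 = y - v 3%:R ^+ 2 by lra.
have dyE : dy = 2^-1 * (1 + y) * (v 1 * x 1 + v 2%:R * x 2%:R + v 3%:R * x 3%:R).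
  have -> : dy = 2^-1 * ((1 - y) * (v 1 * x 1 + v 2%:R * x 2%:R + v 3%:R * x 3%:R) +
      2 * (v 1 * x 1 + v 2%:R * x 2%:R + v 3%:R * x 3%:R) *
      (v 1 ^+ 2 + v 2%:R ^+ 2 + v 3%:R ^+ 2)).
    by rewrite /dy /dv /stereo_field -/y -/v /=; field.
  by rewrite -yv; field.
by elim/ord3P: i; rewrite ?l0 ?l1 ?l2 !mxE sum3E !mxE /= /quat_log_coord /dv /stereo_field;
  rewrite -/y -/v dyE gE /C CE -/y /= sq ?sq1 ?sq2 ?sq3; field; rewrite y0 y1 g0.
Qed.

End Logarithm.
End Quaternions.

(** * The quaternion equation *)

Section QuaternionFlow.
Context {R : realType}.

(** Vectors of R^3 are indexed by 1, 2, 3 in ['I_4], like imaginary quaternions. *)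
Definition hat4 (x : 'I_4 -> R) : 'M[R]_3 := hat (x 1) (x 2%:R) (x 3%:R).
Definition quat_coef (x : 'I_4 -> R) := quat_field (x 1) (x 2%:R) (x 3%:R).

Section AtTime.
Variables (q : 'I_4 -> R -> R) (x : 'I_4 -> R) (t : R).
Let qt i := q i t.
Hypothesis Hq : forall j, is_derive t 1 (q j) (\sum_i qt i * quat_coef x i j).

Lemma rotq_flow i j : is_derive t 1 (fun s => rotq (fun k => q k s) i j)
  ((rotq qt *m hat4 x) i j).
Proof.
pose m k l := derM (Hq k) (Hq l).
move: i j; elim/ord3P; elim/ord3P; under eq_fun do rewrite mxE /=;
  rewrite mxE sum3E !mxE /=.
- apply: (der_eq (derB (derB (derD (m 0 0) (m 1 1)) (m 2%:R 2%:R)) (m 3%:R 3%:R))).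
   rewrite !sum4E /quat_coef /quat_field /=. by rewrite /qt; field.
- apply: (der_eq (derZ 2 (derB (m 1 2%:R) (m 0 3%:R)))).
  by rewrite !sum4E /quat_coef /quat_field /qt /=; field.
- apply: (der_eq (derZ 2 (derD (m 1 3%:R) (m 0 2%:R)))).
  by rewrite !sum4E /quat_coef /quat_field /qt /=; field.
- apply: (der_eq (derZ 2 (derD (m 1 2%:R) (m 0 3%:R)))).
  by rewrite !sum4E /quat_coef /quat_field /qt /=; field.
- apply: (der_eq (derB (derD (derB (m 0 0) (m 1 1)) (m 2%:R 2%:R)) (m 3%:R 3%:R))).
  by rewrite !sum4E /quat_coef /quat_field /qt /=; field.
- apply: (der_eq (derZ 2 (derB (m 2%:R 3%:R) (m 0 1)))).
  by rewrite !sum4E /quat_coef /quat_field /qt /=; field.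
- apply: (der_eq (derZ 2 (derB (m 1 3%:R) (m 0 2%:R)))).
  by rewrite !sum4E /quat_coef /quat_field /qt /=; field.
- apply: (der_eq (derZ 2 (derD (m 2%:R 3%:R) (m 0 1)))).
  by rewrite !sum4E /quat_coef /quat_field /qt /=; field.
- apply: (der_eq (derD (derB (derB (m 0 0) (m 1 1)) (m 2%:R 2%:R)) (m 3%:R 3%:R))).
  by rewrite !sum4E /quat_coef /quat_field /qt /=; field.
Qed.

Lemma qnorm2_flow : is_derive t 1 (fun s => qnorm2 (fun k => q k s)) 0.
Proof.
pose m k := derM (Hq k) (Hq k).
apply: (der_eq (derD (derD (derD (m 0) (m 1)) (m 2%:R)) (m 3%:R))).
by rewrite !sum4E /quat_coef /quat_field /qt /=; field.
Qed.

Variables (g g' : R -> R).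
Hypothesis gatan : forall s, s * g (s ^+ 2) = atan s.
Hypothesis gode : forall x : R, 0 <= x -> is_derive x 1 g (g' x) /\
  2 * x * g' x + g x = (1 + x)^-1.
Hypothesis n1 : qnorm2 qt = 1.
Hypothesis q0 : -1 < qt 0.

Lemma stereo_flow i : i != 0 ->
  is_derive t 1 (fun s => stereo (fun k => q k s) i) (stereo_field qt x i).
Proof.
have h0 : 1 + qt 0 != 0 by rewrite gt_eqF // addrC -ltrBlDr sub0r.
move=> i0; have d := derM (Hq i) (derV (f := fun s => 1 + q 0 s) h0 (derD (der_cst 1 t) (Hq 0))).
apply: (der_eq d); rewrite /stereo_field stereo2E // /stereo -/(qt i) -/(qt 0).
move: i0 {d}; elim/ord4P: i => // _; rewrite !sum4E /quat_coef /quat_field /=; by field.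
Qed.

Lemma quat_log_flow i :
  is_derive t 1 (fun s => vec (quat_log g (fun k => q k s)) i 0)
    (Zfield (quat_log g qt) (hat4 x) i 0).
Proof.
rewrite (Zfield_quat_log gatan (fun x x0 => (gode x0).2)) //.
have d1 := stereo_flow (isT : (1 : 'I_4) != 0).
have d2 := stereo_flow (isT : (2%:R : 'I_4) != 0).
have d3 := stereo_flow (isT : (3%:R : 'I_4) != 0).
have dy : is_derive t 1 (fun s => stereo2 (fun k => q k s))
  (2 * (stereo qt 1 * stereo_field qt x 1 + stereo qt 2%:R * stereo_field qt x 2%:R +
        stereo qt 3%:R * stereo_field qt x 3%:R)).
  by apply: (der_eq (derD (derD (derM d1 d1) (derM d2 d2)) (derM d3 d3))); rewrite -/qt; ring.
have dg := @is_derive1_comp R g (fun s => stereo2 (fun k => q k s)) t _ _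
   (gode (stereo2_ge0 qt)).1 dy.
have dc k : k != 0 -> is_derive t 1 (fun s => quat_log_coord g (fun k => q k s) k)
    (4 * (g' (stereo2 qt) * (2 * (stereo qt 1 * stereo_field qt x 1 + stereo qt 2%:R * stereo_field qt x 2%:R +
        stereo qt 3%:R * stereo_field qt x 3%:R)) * stereo qt k + g (stereo2 qt) * stereo_field qt x k)).
  move=> k0; apply: (der_eq (derM (derZ 4 dg) (stereo_flow k0))); rewrite /= -/qt; ring.
have vE k s : vec (quat_log g (fun k => q k s)) k 0 = quat_log_coord g (fun k => q k s) (lift ord0 k).
  rewrite /quat_log vec_hat mxE; elim/ord3P: k => /=;
  by congr quat_log_coord; apply: val_inj.
under eq_fun do rewrite vE; exact: dc.
Qed.

End AtTime.
End QuaternionFlow.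

(** * One-sided derivatives and uniqueness for A' = A X *)

Section OneSidedDerivatives.
Context {R : realType}.

Lemma deriv_ge0_is_derive (f : R -> R) (t l : R) : 0 < t ->
  deriv_ge0 f t l -> is_derive t 1 f l.
Proof.
move=> t0 H.
have lim : h^-1 *: ((f \o shift t) (h *: (1 : R)) - f t) @[h --> (0 : R)^'] --> l.
  apply/cvgrPdist_le => e e0.
  move/cvgrPdist_le: H => /(_ e e0) H.
  have nt : \forall h \near (0 : R)^', 0 <= t + h.
    exists t => //= h; rewrite /ball_ /= sub0r normrN => ht _.
    by move: ht; rewrite ltr_norml => /andP[? ?]; lra.
  rewrite near_withinE in H.
  apply: filterS2 H nt => h H1 H2.
  by have := H1 H2; rewrite /GRing.scale /= mulr1 (addrC h).
by split; [apply/cvg_ex; exists l|apply: cvg_lim].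
Qed.

Lemma deriv_ge0_cvg0 (f : R -> R) (l : R) :
  deriv_ge0 f 0 l -> f h @[h --> (0 : R)^'+] --> f 0.
Proof.
move=> H.
have H1 : h^-1 *: (f (0 + h) - f 0) @[h --> (0 : R)^'+] --> l.
  apply: cvg_trans H; apply: cvg_app => P; rewrite /within /=.
  move=> [e /= e0 He]; exists e => //= h hb h0.
  by apply: He => //; [rewrite gt_eqF|rewrite add0r ltW].
have H2 : h * (h^-1 *: (f (0 + h) - f 0)) + f 0 @[h --> (0 : R)^'+] --> 0 * l + f 0.
  apply: cvgD; last exact: cvg_cst.
  apply: cvgM => //; exact: cvg_at_right_filter cvg_id.
move: H2; rewrite mul0r add0r; apply: cvg_trans; apply: near_eq_cvg.
exists 1 => //= h _ h0.
by rewrite /GRing.scale /= mulrA divff ?mul1r ?subrK ?add0r // gt_eqF.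
Qed.

Lemma deriv_ge0_coord p r (A : R -> 'M[R]_(p, r)) (t : R) (L : 'M[R]_(p, r)) i j :
  deriv_ge0 A t L -> deriv_ge0 (fun s => A s i j) t (L i j).
Proof.
move=> H; rewrite /deriv_ge0.
have := cvg_comp _ _ H (@coord_continuous R p r i j L).
apply: cvg_trans; apply: near_eq_cvg; near=> h.
by rewrite /= !mxE.
Unshelve. all: by end_near. Qed.

Lemma is_derive_deriv_ge0 p r (A : R -> 'M[R]_(p, r)) (t : R) (L : 'M[R]_(p, r)) :
  (forall i j, is_derive t 1 (fun s => A s i j) (L i j)) -> deriv_ge0 A t L.
Proof.
move=> H.
have dA : derivable A t 1 by apply/derivable_mxP => i j; exact: ex_derive.
have DA : 'D_1 A t = L.
  by rewrite derive_mx //; apply/matrixP => i j; rewrite mxE; exact: derive_val.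
have lim : h^-1 *: ((A \o shift t) (h *: (1 : R)) - A t) @[h --> (0 : R)^'] --> L.
  by rewrite -DA; exact: dA.
rewrite /deriv_ge0; apply: cvg_within_filter.
apply: cvg_trans lim; apply: near_eq_cvg; near=> h.
have h1 : h *: (1 : R) = h by exact: mulr1.
by rewrite /= h1 (addrC h).
Unshelve. all: by end_near. Qed.

(** The product A B^T is constant, because its derivative is A (X + X^T) B^T = 0. *)
Lemma attitude_unique (A B X : R -> 'M[R]_3) (T : R) :
  0 <= T ->
  (forall t : R, 0 <= t <= T -> so3 (X t)) ->
  (forall t : R, 0 <= t <= T -> deriv_ge0 A t (A t *m X t)) ->
  (forall (t : R) i j, 0 <= t <= T -> is_derive t 1 (fun s => B s i j) ((B t *m X t) i j)) ->
  (forall t : R, 0 <= t <= T -> (B t)^T *m B t = 1%:M) ->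
  A 0 = B 0 -> A T = B T.
Proof.
move=> T0 hX dA dB oB AB0.
have [T00|Tp] := eqVneq T 0; first by rewrite T00.
have {}Tp : 0 < T by rewrite lt_def Tp.
have oB' t : 0 <= t <= T -> B t *m (B t)^T = 1%:M.
  by move=> tT; exact: mulmx1C (oB t tT).
pose phi i j t := \sum_k A t i k * B t j k.
have phiE t : \matrix_(i, j) phi i j t = A t *m (B t)^T.
  by apply/matrixP => i j; rewrite !mxE; apply: eq_bigr => k _; rewrite mxE.
have dphi i j t : 0 < t <= T -> is_derive t 1 (phi i j) 0.
  move=> /andP[t0 tT]; have tT' : 0 <= t <= T by rewrite ltW.
  have dAt k := deriv_ge0_is_derive t0 (@deriv_ge0_coord _ _ A t _ i k (dA t tT')).
  apply: (der_eq (der_sum (fun k => derM (dAt k) (dB t j k tT')))).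
  transitivity ((A t *m X t *m (B t)^T + A t *m (B t *m X t)^T) i j).
    rewrite !mxE -big_split /=; apply: eq_bigr => k _.
    by rewrite !mxE.
  by rewrite trmx_mul (hX t tT') mulNmx mulmxN mulmxA subrr mxE.
have cphi i j : {within `[0, T], continuous (phi i j)}.
  apply/continuous_within_itvP => //; split.
  - move=> t; rewrite in_itv /= => /andP[t0 tT].
    by apply: der_continuous (dphi i j t _); rewrite t0 ltW.
  - rewrite /phi; elim: (index_enum _) => [|k s IH].
      by rewrite big_nil; under eq_fun do rewrite big_nil; exact: cvg_cst.
    rewrite big_cons; under eq_fun do rewrite big_cons.
    have T0' : 0 <= (0 : R) <= T by rewrite lexx.
    apply: (@cvgD _ _ _ _ _ (fun t => A t i k * B t j k)) => //; apply: cvgM.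
      exact: deriv_ge0_cvg0 (@deriv_ge0_coord _ _ A 0 _ i k (dA 0 T0')).
    apply: cvg_at_right_filter; exact: der_continuous (dB 0 j k T0').
  - apply: cvg_at_left_filter; apply: der_continuous (dphi i j T _).
    by rewrite Tp lexx.
have phi_cst i j : phi i j T = phi i j 0.
  have [|c _ /eqP] := @MVT_segment R (phi i j) (fun=> 0) 0 T T0 _ (cphi i j).
    by move=> t; rewrite in_itv /= => /andP[t0 tT]; apply: dphi; rewrite t0 ltW.
  by rewrite mul0r subr_eq0 => /eqP.
have E : A T *m (B T)^T = 1%:M.
  rewrite -phiE (_ : \matrix_(i, j) phi i j T = \matrix_(i, j) phi i j 0).
    by rewrite phiE AB0 oB' // lexx.
  by apply/matrixP => i j; rewrite !mxE phi_cst.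
have TT : 0 <= T <= T by rewrite T0 lexx.
by rewrite -[LHS]mulmx1 -(oB T TT) mulmxA E mul1mx.
Qed.

End OneSidedDerivatives.

(** * Local quaternion lifts *)

Section Assembly.
Context {R : realType}.

(** Tube lemma for the segment [0, T] x {x}; the tube extends it in time on both
    sides. *)
Lemma segment_tube (U : set (R * R)) (T x : R) :
  open U -> 0 <= T -> (forall t, 0 <= t <= T -> U (t, x)) ->
  exists2 d : R, 0 < d & forall s y, - d <= s <= T + d -> `|y - x| < d -> U (s, y).
Proof.
move=> oU T0 HU.
have K := (@compact_near_coveringP _ _).1 (@segment_compact R 0 T).
have /near_planeP [r r0 Hr] : \forall h \near ((0 : R), x), `[0, T]%classic `<=`
    (fun t => U (t + h.1, h.2)).
  apply: (K (R * R)%type (nbhs ((0 : R), x)) (fun h t => U (t + h.1, h.2))) => t.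
  rewrite /= in_itv /= => tT.
  have [r r0 H] : exists2 r : R, 0 < r & forall q : R * R, `|q.1 - t| < r -> `|q.2 - x| < r -> U q.
    by apply/(near_planeP (t, x)); exact: open_nbhs_nbhs (conj oU (HU t tT)).
  have r2 : 0 < r / 2 by lra.
  exists (ball t (r / 2), [set h : R * R | `|h.1 - 0| < r / 2 /\ `|h.2 - x| < r]).
    split; first exact: nbhsx_ballx.
    apply/(near_planeP (0, x)); exists (r / 2) => // q h1 h2; split=> //.
    by apply: (lt_trans h2); lra.
  move=> [s h] [/=]; rewrite /ball /= subr0 distrC => hs [h1 h2].
  apply: H => //=; rewrite addrAC (le_lt_trans (ler_normD _ _)) //.
  by rewrite [r]splitr ltrD.
exists (r / 2); first lra.
move=> s y /andP[s1 s2] yx.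
have yx' : `|y - x| < r by apply: (lt_trans yx); lra.
have H (t h : R) : 0 <= t <= T -> `|h| < r -> U (t + h, y).
  by move=> tT hr; apply: (Hr (h, y)) => //=; rewrite subr0.
have [s0|s0] := ltP s 0.
  rewrite -[s]add0r; apply: H; first by rewrite lexx.
  by rewrite ltr0_norm; lra.
have [sT|sT] := leP s T.
  by rewrite -[s]addr0; apply: H; [rewrite s0|rewrite normr0].
rewrite -[s](subrKC T); apply: H; first by rewrite T0 lexx.
by rewrite gtr0_norm; lra.
Qed.

Definition velocity (X : R * R -> 'M[R]_3) (p : R * R) (i : 'I_4) : R :=
  nth 0 [:: 0; X p 2%:R 1; X p 0 2%:R; X p 1 0] i.

Lemma velocity_hat (X : R * R -> 'M[R]_3) p : so3 (X p) -> hat4 (velocity X p) = X p.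
Proof. by move=> /so3_hat E; rewrite [RHS]E. Qed.

(** The solution lives on a full neighbourhood of the segment, with negative times
    and parameters on both sides of [x0]. Regularity on a set with boundary asks
    for an extension to a neighbourhood, and this solution supplies it. *)
Lemma local_quaternion m (U : set (R * R)) (X : R * R -> 'M[R]_3) (T x0 : R) :
  open U -> 0 <= T -> (forall t, 0 <= t <= T -> U (t, x0)) ->
  (forall i j, Ck m U (fun p => X p i j)) ->
  exists (d : R) (q : 'I_4 -> R * R -> R),
  [/\ 0 < d,
      (forall j, Ck m (obox (- d) (T + d) (ball x0 d)) (q j)),
      (forall t x j, - d <= t <= T + d -> `|x - x0| < d ->
         is_derive t 1 (fun s => q j (s, x))
           (\sum_i q i (t, x) * quat_coef (velocity X (t, x)) i j)),
      (forall t x, - d <= t <= T + d -> `|x - x0| < d -> qnorm2 (fun j => q j (t, x)) = 1)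
    & (forall x, `|x - x0| < d -> rotq (fun j => q j (0, x)) = 1%:M)].
Proof.
move=> oU T0 HU CX.
have [d d0 Hd] := segment_tube oU T0 HU.
have ab0 : - d <= 0 <= T + d by lra.
have oJ : open (ball x0 d) by exact: ball_open.
have HJ t x : - d <= t <= T + d -> ball x0 d x -> U (t, x).
  by move=> tab; rewrite /ball /= distrC; exact: Hd.
pose V i j p := quat_coef (velocity X p) i j.
have Cv k : Ck m U (fun p => velocity X p k).
  by rewrite /velocity; elim/ord4P: k; rewrite /=; [exact: Ck_cst|exact: CX..].
have CN f : Ck m U f -> Ck m U (fun p => - f p) := @Ck_opp R _ m U f oU.
have CV i j : Ck m U (V i j).
  rewrite /V /quat_coef /quat_field; apply: (Ck_mul oU); first exact: Ck_cst.
  by elim/ord4P: i; elim/ord4P: j; rewrite /=; try exact: Ck_cst; try exact: Cv; apply: CN; exact: Cv.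
have [q [q0 Hq Cq]] := ode_smooth_family (fun j : 'I_4 => (j == 0)%:R) ab0 oJ oU HJ CV.
have Hq' t x j : - d <= t <= T + d -> `|x - x0| < d ->
    is_derive t 1 (fun s => q j (s, x)) (\sum_i q i (t, x) * quat_coef (velocity X (t, x)) i j).
  by move=> tab xd; apply: Hq => //; rewrite /ball /= distrC.
have q0' x j : `|x - x0| < d -> q j (0, x) = (j == 0)%:R.
  by move=> xd; apply: q0; rewrite /ball /= distrC.
exists d, q; split=> //.
- move=> t x tab xd.
  have n0 : qnorm2 (fun j => q j (0, x)) = 1.
    by rewrite /qnorm2 !q0' //= !expr0n /= !addr0 expr1n.
  have dn s : - d <= s <= T + d -> is_derive s 1 (fun s => qnorm2 (fun j => q j (s, x))) 0.
    by move=> sab; apply: (@qnorm2_flow R (fun j s => q j (s, x)) (velocity X (s, x)) s) => j; exact: Hq'.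
  have [t0|t0] := leP 0 t.
    rewrite -n0; apply/esym.
    by apply: (@der0_cst R (fun s => qnorm2 (fun j => q j (s, x))) 0 t t0) => s st; apply: dn; lra.
  rewrite -n0.
  by apply: (@der0_cst R (fun s => qnorm2 (fun j => q j (s, x))) t 0 (ltW t0)) => s st; apply: dn; lra.
- move=> x xd; apply/matrixP; elim/ord3P; elim/ord3P; rewrite !mxE /= !q0' //=; ring.
Qed.

End Assembly.

(** * The angular velocity along the bifurcating solution *)

Section Main.
Context {R : realType}.

Lemma Ck_comp_rV2 n (U : set (R * R)) (f : 'rV[R]_2 * R -> R)
    (g : R * R -> 'rV[R]_2) (h : R * R -> R) : open U ->
  Ck n setT f -> Ck n U g -> Ck n U h -> Ck n U (fun p => f (g p, h p)).
Proof.
move=> oU Cf Cg Ch.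
pose b (i : 'I_3) : 'rV[R]_2 * R :=
  if i == 0 then (delta_mx 0 0, 0) else if i == 1 then (delta_mx 0 1, 0) else (0, 1).
pose c (i : 'I_3) (w : 'rV[R]_2 * R) : R :=
  if i == 0 then w.1 0 0 else if i == 1 then w.1 0 1 else w.2.
have cE (k : 'I_2) : continuous (fun w : 'rV[R]_2 * R => w.1 0 k).
  move=> w; apply: (@continuous_comp _ _ _ fst (fun v : 'rV[R]_2 => v 0 k)); first exact: cvg_fst.
  exact: coord_continuous.
apply: (@Ck_comp R _ ('rV[R]_2 * R)%type n 3 b c U setT f (fun p => (g p, h p))) => //.
- by move=> i k u v; rewrite /c; case: (i == 0); [|case: (i == 1)]; rewrite /= ?mxE.
- move=> i; rewrite /c; case: (i == 0); [exact: cE|case: (i == 1); first exact: cE].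
  by move=> w; exact: cvg_snd.
- move=> [v x]; rewrite sum3E /b /c /=.
  apply/pair_equal_spec; split; last by rewrite /= /GRing.scale /= !mulr0 mulr1 !add0r.
  apply/rowP => j; rewrite !mxE; case: j => [[|[|//]]] lj.
    by rewrite (_ : Ordinal lj = 0) ?eqxx /= ?mulr1 ?mulr0 ?addr0 //; exact: val_inj.
  by rewrite (_ : Ordinal lj = 1) ?eqxx /= ?mulr1 ?mulr0 ?addr0 ?add0r //; exact: val_inj.
- exact: Ck_pair.
Qed.

(** The definition of X^G by cases at lambda = 0 agrees with X_G(q, lambda), as
    q(t, 0) = 0 and X_G(0, 0) = X_0; in the variable x = sqrt lambda it is thus a
    composition of regular maps. *)
Lemma angular_velocity_CS n (lam0 : R) (XG : 'rV[R]_2 -> R -> 'M[R]_3) (X0 : 'M[R]_3)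
    (q : R -> R -> 'rV[R]_2) :
  Ck n setT (fun p : 'rV[R]_2 * R => XG p.1 p.2) -> XG 0 0 = X0 ->
  CS_on n (strip lam0) q -> (forall t, 0 <= t -> q t 0 = 0) ->
  exists (U : set (R * R)) (g : R * R -> 'rV[R]_2),
  let X p := XG (g p) (p.2 ^+ 2) in
  [/\ open U,
      (forall t x, 0 <= t -> 0 <= x -> x ^+ 2 < lam0 -> U (t, x)),
      (forall i j, Ck n U (fun p => X p i j))
    & (forall t x, 0 <= t -> 0 <= x -> x ^+ 2 < lam0 -> X (t, x) = XGt XG X0 q t (x ^+ 2))].
Proof.
move=> CXG XG0 [U [g [oU sU Cg gq]]] q0; exists U, g; split=> //.
- by move=> t x t0 x0 xl; apply: sU; split=> //=; split=> //=; rewrite sqr_ge0.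
- move=> i j; apply: (@Ck_comp_rV2 n U (fun z => XG z.1 z.2 i j)) => //.
    exact: (Ck_coord i j openT CXG).
  by apply: (Ck_mul oU); exact: Ck_snd.
- move=> t x t0 x0 xl; rewrite -gq /=; last by split=> //; split=> //=; rewrite sqr_ge0.
  by rewrite /XGt; case: eqP => // ->; rewrite q0 // XG0.
Qed.

End Main.

(** * The initial value problem for Z *)

Theorem theorem5p5 (R : realType) (m : nat) (m_ge1 : (1 <= m)%N) :
  exists M : nat,
  forall (E : rd_system R) (H : phase_spaces E)
    (u0 : ps_Ya H) (X0 : 'M[R]_3)
    (P : {linear ps_Y H -> ps_Y H}) (vstar : 'I_2 -> ps_Y H)
    (lam0 : R) (U : set 'rV[R]_2) (Psi : 'rV[R]_2 -> R -> ps_Ya H)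
    (XG : 'rV[R]_2 -> R -> 'M[R]_3) (XN : 'rV[R]_2 -> R -> 'rV[R]_2)
    (a b : R -> R) (omega_bif : R) (omega : R -> R)
    (q : R -> R -> 'rV[R]_2) (A : R -> R -> 'M[R]_3),
  (M <= (rd_reg E).+2)%N ->
  relative_equilibrium u0 X0 ->
  spectral_hypothesis u0 X0 P ->
  is_basis (Vstar u0 P) vstar ->
  0 < lam0 ->
  center_manifold M u0 X0 P lam0 U Psi XG XN ->
  supercritical_hopf M lam0 XN a b omega_bif omega q ->
  (forall lam : R, 0 <= lam < lam0 ->
     A 0 lam = 1%:M /\
     forall t : R, 0 <= t ->
       deriv_ge0 (fun s => A s lam) t (A t lam *m XGt XG X0 q t lam)) ->
  exists2 lam1 : R, 0 < lam1 <= lam0 &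
  exists Z : R -> R -> 'M[R]_3,
    [/\ forall t lam : R, 0 <= t -> 0 <= lam < lam1 -> qD X0 (Z t lam),
        CS_qD m (strip lam1) Z,
        forall t lam : R, 0 <= t -> 0 <= lam < lam1 -> A t lam = expM (Z t lam),
        forall lam : R, 0 <= lam < lam1 -> vec (Z 0 lam) = vec 0
      & forall p, strip lam1 p ->
          exists (N : set (R * R)) (W : R -> R -> 'M[R]_3),
            [/\ open N, N p, local_rep m (strip lam1 `&` N) Z W
              & forall t lam, strip lam1 (t, lam) -> N (t, lam) ->
                  deriv_ge0 (fun s => vec (W s lam)) t
                    (Zfield (W t lam) (XGt XG X0 q t lam))]].
Proof.
case: m m_ge1 => [//|m] _; exists m.+1.
move=> E H u0 X0 P vstar lam0 U Psi XG XN a b omega_bif omega q A.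
move=> _ _ _ _ lam00 CM HB HA.
have [Om [gq [oOm OmS CX XE]]] := angular_velocity_CS (cm_XG_smooth CM) (cm_XG0 CM)
  (hopf_smooth HB) (hopf_q0 HB).
pose X (p : R * R) := XG (gq p) (p.2 ^+ 2).
have {}CX i j : Ck m.+1 Om (fun p => X p i j) by exact: CX.
have {}XE t x : 0 <= t -> 0 <= x -> x ^+ 2 < lam0 -> X (t, x) = XGt XG X0 q t (x ^+ 2).
  exact: XE.
have soX p : so3 (X p) by exact: cm_XG_so3 CM _ _.
have [Vg [g [g' [oVg Vg0 Cg gatan gode]]]] := @atan_quotient_smooth R m.
have lift (t0 x0 : R) : 0 <= t0 -> 0 <= x0 -> x0 ^+ 2 < lam0 ->
  exists (d : R) (Q : 'I_4 -> R * R -> R),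
  [/\ 0 < d, 0 <= Q 0 (t0, x0),
      (forall j, Ck m.+1 (obox (- d) (t0 + d) (ball x0 d)) (Q j)),
      (forall t x j, - d <= t <= t0 + d -> `|x - x0| < d ->
         is_derive t 1 (fun s => Q j (s, x))
           (\sum_i Q i (t, x) * quat_coef (velocity X (t, x)) i j))
    & (forall t x, 0 <= t <= t0 + d -> `|x - x0| < d -> 0 <= x -> x ^+ 2 < lam0 ->
        qnorm2 (fun j => Q j (t, x)) = 1 /\ rotq (fun j => Q j (t, x)) = A t (x ^+ 2))].
  move=> t00 x00 xl0.
  have [|d [Q [d0 CQ dQ nQ Q0]]] := @local_quaternion R m.+1 Om X t0 x0 oOm t00 _ CX.
    by move=> t /andP[tp _]; exact: OmS.
  have rotA t x : 0 <= t <= t0 + d -> `|x - x0| < d -> 0 <= x -> x ^+ 2 < lam0 ->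
      rotq (fun j => Q j (t, x)) = A t (x ^+ 2).
    move=> /andP[tp td] xd xp xl.
    have [A0 dA] := HA (x ^+ 2) (ltac:(by rewrite sqr_ge0)).
    apply/esym; apply: (@attitude_unique R (fun t => A t (x ^+ 2))
      (fun t => rotq (fun j => Q j (t, x))) (fun t => X (t, x)) t) => //.
    - by move=> s /andP[s0 _]; rewrite XE //; exact: dA.
    - move=> s i j /andP[s0 st]; rewrite -(velocity_hat (soX (s, x))).
      apply: (@rotq_flow R (fun j s => Q j (s, x)) (velocity X (s, x)) s) => k.
      by apply: dQ => //; lra.
    - by move=> s /andP[s0 st]; apply: rotq_orth; apply: nQ => //; lra.
    - by rewrite A0 Q0.
  (* Q and - Q have the same rotation matrix: the one with nonnegative real part
     at the given point stays away from -1 nearby *)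
  have [q0|q0] := leP 0 (Q 0 (t0, x0)).
    exists d, Q; split=> // t x /andP[tp td] xd xp xl; split.
      by apply: nQ => //; lra.
    by apply: rotA => //; rewrite tp.
  exists d, (fun j p => - Q j p); split=> //.
  - by rewrite oppr_ge0 ltW.
  - by move=> j; apply: Ck_opp => //; apply: open_obox; exact: ball_open.
  - move=> t x j tab xd; have := derZ (-1) (dQ t x j tab xd).
    under eq_fun do rewrite mulN1r; move=> h; apply: (der_eq h).
    by rewrite mulN1r -sumrN; apply: eq_bigr => i _; rewrite mulNr.
  - move=> t x /andP[tp td] xd xp xl; split.
      have := nQ t x (ltac:(lra)) xd; rewrite /qnorm2 => <-; rewrite !sqrrN //.
    by rewrite rotqN; apply: rotA => //; rewrite tp.
have logA (p : R * R) : exists Y : 'M[R]_3, strip lam0 p ->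
    [/\ so3 Y, anorm Y <= pi & expM Y = A p.1 p.2].
  have [[/= tp /andP[lp ll]]|nS] := pselect (strip lam0 p); last by exists 0 => /nS.
  pose x := Num.sqrt p.2.
  have x2 : x ^+ 2 = p.2 by rewrite sqr_sqrtr.
  have xp : 0 <= x by exact: sqrtr_ge0.
  have xl : x ^+ 2 < lam0 by rewrite x2.
  have [d [Q [d0 Qp CQ dQ QA]]] := lift p.1 x tp xp xl.
  have tin : 0 <= p.1 <= p.1 + d by rewrite tp lerDl ltW.
  have xin : `|x - x| < d by rewrite subrr normr0.
  have [n1 rA] := QA p.1 x tin xin xp xl.
  exists (quat_log g (fun j => Q j (p.1, x))) => _; split.
  - exact: hat_so3.
  - exact: quat_log_lepi.
  - rewrite expM_quat_log //; first by rewrite rA x2.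
    by apply: lt_le_trans Qp; rewrite ltrN10.
have [Y HY] := choice logA.
pose Z t lam := qmap X0 (Y (t, lam)).
have Zspec t lam : 0 <= t -> 0 <= lam < lam0 ->
    [/\ so3 (Z t lam), anorm (Z t lam) < 2 * pi & expM (Z t lam) = A t lam].
  move=> t0 l0; have [h1 h2 h3] := HY (t, lam) (conj t0 l0).
  by have [z1 z2 z3] := qmap_spec X0 h1 h2; split=> //; rewrite z3.
have main p : strip lam0 p -> exists (N : set (R * R)) (W : R -> R -> 'M[R]_3),
    [/\ open N, N p, local_rep m.+1 (strip lam0 `&` N) Z W
      & forall t lam, strip lam0 (t, lam) -> N (t, lam) ->
          deriv_ge0 (fun s => vec (W s lam)) t
            (Zfield (W t lam) (XGt XG X0 q t lam))].
  move=> [tp /andP[lp ll]].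
  pose x0 := Num.sqrt p.2.
  have x02 : x0 ^+ 2 = p.2 by rewrite sqr_sqrtr.
  have x0p : 0 <= x0 by exact: sqrtr_ge0.
  have x0l : x0 ^+ 2 < lam0 by rewrite x02.
  have [d [Q [d0 Qp CQ dQ QA]]] := lift p.1 x0 tp x0p x0l.
  set box := obox _ _ _ in CQ.
  have obx : open box by apply: open_obox; exact: ball_open.
  (* the logarithm is smooth where the real part exceeds -1 *)
  pose N' := box `&` Q 0 @^-1` [set y : R | -1 < y].
  have oN' : open N'.
    rewrite openE => z [bz qz]; apply: filterI; first exact: open_nbhs_nbhs.
    apply: (Ck_cont (CQ 0) bz); apply: open_nbhs_nbhs; split=> //; exact: open_gt.
  have N'box : N' `<=` box by move=> z [].
  have CQ' j : Ck m.+1 N' (Q j) := Ck_sub N'box (CQ j).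
  pose L (z : R * R) := quat_log g (fun j => Q j z).
  have CL : Ck m.+1 N' L.
    have Cs i : Ck m.+1 N' (fun z => stereo (fun j => Q j z) i).
      apply: (Ck_mul oN' (CQ' i)); apply: (Ck_inv oN').
        by move=> z [_ /= qz]; rewrite gt_eqF //; lra.
      by apply: (Ck_add oN'); [exact: Ck_cst|exact: CQ'].
    have Csq i : Ck m.+1 N' (fun z => stereo (fun j => Q j z) i ^+ 2).
      exact: (Ck_mul oN' (Cs i) (Cs i)).
    have Cc i : Ck m.+1 N' (fun z => quat_log_coord g (fun j => Q j z) i).
      apply: (Ck_mul oN' _ (Cs i)); apply: (Ck_mul oN'); first exact: Ck_cst.
      apply: (Ck_comp1 oN' _ Cg); first by move=> z _; apply: Vg0; exact: stereo2_ge0.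
      by apply: (Ck_add oN'); [apply: (Ck_add oN')|]; exact: Csq.
    have CN f : Ck m.+1 N' f -> Ck m.+1 N' (fun z => - f z) := @Ck_opp R _ _ _ f oN'.
    apply: (Ck_mx oN'); elim/ord3P; elim/ord3P; under eq_fun do rewrite mxE /=;
      solve [exact: Ck_cst | exact: Cc | apply: CN; exact: Cc].
  pose phi (z : R * R) : R * R := (z.1, Num.sqrt z.2).
  exists (phi @^-1` N'), (fun t lam => L (t, Num.sqrt lam)).
  have Nin t lam : strip lam0 (t, lam) -> N' (t, Num.sqrt lam) ->
      [/\ - d < t < p.1 + d, `|Num.sqrt lam - x0| < d, Num.sqrt lam ^+ 2 = lam,
          -1 < Q 0 (t, Num.sqrt lam)
        & qnorm2 (fun j => Q j (t, Num.sqrt lam)) = 1 /\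
          rotq (fun j => Q j (t, Num.sqrt lam)) = A t lam].
    move=> [/= t0 /andP[l0 l1]] [[/= tb]]; rewrite /ball /= distrC => xb q1.
    have s2 : Num.sqrt lam ^+ 2 = lam by rewrite sqr_sqrtr.
    have tb' : 0 <= t <= p.1 + d by lra.
    have [n1 rA] := QA t (Num.sqrt lam) tb' xb (sqrtr_ge0 _) (ltac:(by rewrite s2)).
    by split=> //; rewrite rA s2.
  have NL (z : R * R) : 0 <= z.2 -> N' (phi (z.1, z.2 ^+ 2)) -> N' z.
    by move=> z0; rewrite /phi /= sqrtr_sqr ger0_norm // -surjective_pairing.
  split.
  - apply: open_comp => [z _|//]; rewrite /phi.
    apply: (@cvg_pair _ _ _ (nbhs z) (nbhs z.1) (nbhs (Num.sqrt z.2)) _ _ _ fst (fun z : R * R => Num.sqrt z.2)).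
      exact: cvg_fst.
    apply: (@continuous_comp _ _ _ snd (Num.sqrt : R -> R)); first exact: cvg_snd.
    exact: sqrt_continuous.
  - split; first split=> /=.
    + by lra.
    + by apply: ballxx.
    + by apply: lt_le_trans Qp; rewrite ltrN10.
  - split.
      exists N', L; split=> //.
        by move=> z [z0 [_ Nz]]; exact: NL.
      by move=> z [z0 _]; rewrite /= sqrtr_sqr ger0_norm // -surjective_pairing.
    move=> [t lam] [S Nt] /=; have [tb xb s2 q1 [n1 rA]] := Nin t lam S Nt.
    case: (S) => /= t0 l0; have [z1 z2 z3] := Zspec t lam t0 l0.
    split; [exact: hat_so3|exact: quat_log_lt2pi|].
    apply: mod2pi_expM => //; [exact: hat_so3|exact: quat_log_lt2pi|].
    by rewrite z3 expM_quat_log.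
  - move=> t lam S Nt; have [tb xb s2 q1 [n1 rA]] := Nin t lam S Nt.
    case: (S) => /= t0 /andP[l0 l1].
    apply: is_derive_deriv_ge0 => i j; rewrite ord1.
    have -> : XGt XG X0 q t lam = hat4 (velocity X (t, Num.sqrt lam)).
      by rewrite velocity_hat // XE ?s2 // sqrtr_ge0.
    apply: (@quat_log_flow R (fun j s => Q j (s, Num.sqrt lam)) _ t _ g g') => // k.
    by apply: dQ => //; lra.
exists lam0; first by rewrite lam00 lexx.
exists Z; split.
- move=> t lam t0 l0; have [h1 h2 h3] := HY (t, lam) (conj t0 l0).
  by exists (Y (t, lam)).
- by move=> p Sp; have [N [W [h1 h2 h3 _]]] := main p Sp; exists N, W.
- by move=> t lam t0 l0; have [_ _ ->] := Zspec t lam t0 l0.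
- move=> lam l0; have [z1 z2 z3] := Zspec 0 lam (lexx _) l0.
  by rewrite (expM_eq1 z1 z2) // z3 (HA lam l0).1.
- exact: main.
Qed.
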